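(* Let $E$ be a proper weak-star closed subspace of $H^\infty$. Let $f\in H^\infty$ be such that the coset $f+E$ has norm $1$ in $H^\infty/E$. Then the following are equivalent: (i) $f+E$ is an extreme point of $\mathrm{ball}\,(H^\infty/E)$; (ii) there is a function $h\in H^\infty$ with $\|h\|_\infty=1$ and $\log(1-|h|)\notin L^1$ such that $\mathcal{M}(f;H^\infty,E)=\{h\}$.
   Context: $\mathbb{T}$ is the unit circle with normalized Haar measure $m$, $L^p=L^p(\mathbb{T},m)$, $H^p=\{f\in L^p:\widehat f(k)=0\ \forall k<0\}$ where $\widehat f(k)=\int_{\mathbb{T}}\bar\zeta^kf\,dm$, and $H^1_0=\{f\in H^1:\widehat f(0)=0\}$. $H^\infty$ (with the sup norm $\|\cdot\|_\infty$) is regarded as the dual of $L^1/H^1_0$, and ''weak-star closed'' refers to this duality. For a Banach space $X$ and closed subspace $Y$: $X/Y$ carries the quotient norm $\|x+Y\|=\inf_{y\in Y}\|x+y\|$, and $\mathcal{M}(x;X,Y):=\{\xi\in x+Y:\|\xi\|=\|x+Y\|_{X/Y}\}$. $\mathrm{ball}\,(Z)$ is the closed unit ball of a Banach space $Z$; a point of it is extreme if it is not the midpoint of two distinct points of the ball. *)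

(* Defs.v *)
From HB Require Import structures.
From mathcomp Require Import all_boot all_order all_algebra.
From mathcomp Require Import complex.
From mathcomp Require Import all_classical all_reals all_analysis.
Set Implicit Arguments. Unset Strict Implicit. Unset Printing Implicit Defensive.
Import Order.TTheory GRing.Theory Num.Theory.
Import numFieldNormedType.Exports.
Local Open Scope classical_set_scope.
Local Open Scope ring_scope.

(* The unit circle T is parametrized by t in [0,1] via t |-> exp(2 pi i t);
   normalized Haar measure m corresponds to Lebesgue measure on [0,1].
   Functions on T are represented as functions R -> R[i] (values outside
   [0,1] are irrelevant). *)

Section Defs.
Variable R : realType.

Definition circ : set R := `[0%R, 1%R]%classic.
Definition leb := (@lebesgue_measure R).

Definition cabs (z : R[i]) : R := Num.sqrt (complex.Re z ^+ 2 + complex.Im z ^+ 2).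

Definition cmeas (f : R -> R[i]) : Prop :=
  measurable_fun circ (fun t => complex.Re (f t)) /\ measurable_fun circ (fun t => complex.Im (f t)).

Definition cint (f : R -> R[i]) : R[i] :=
  Complex (Rintegral leb circ (fun t => complex.Re (f t)))
          (Rintegral leb circ (fun t => complex.Im (f t))).

Definition L1 (f : R -> R[i]) : Prop :=
  leb.-integrable circ (fun t => (complex.Re (f t))%:E) /\
  leb.-integrable circ (fun t => (complex.Im (f t))%:E).

Definition Linf (f : R -> R[i]) : Prop :=
  cmeas f /\ exists M : R, {ae leb, forall t, circ t -> cabs (f t) <= M}.

Definition normInf (f : R -> R[i]) : R :=
  inf [set M : R | 0 <= M /\ {ae leb, forall t, circ t -> cabs (f t) <= M}].

Definition aeeq (f g : R -> R[i]) : Prop :=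
  {ae leb, forall t, circ t -> f t = g t}.

Definition zeta_pow (k : int) (t : R) : R[i] :=
  Complex (cos (2 * pi * k%:~R * t)) (sin (2 * pi * k%:~R * t)).

Definition fourier (f : R -> R[i]) (k : int) : R[i] :=
  cint (fun t => conjc (zeta_pow k t) * f t).

Definition Hinf (f : R -> R[i]) : Prop :=
  Linf f /\ forall k : int, (k < 0)%R -> fourier f k = 0.

(* E is a (linear) subspace of H^infty; functions are identified a.e.,
   so E is saturated under a.e. equality within H^infty. *)
Definition subspace_Hinf (E : set (R -> R[i])) : Prop :=
  [/\ E `<=` Hinf,
      E (fun _ => 0),
      (forall f g, E f -> E g -> E (fun t => f t + g t)),
      (forall (c : R[i]) f, E f -> E (fun t => c * f t)) &
      (forall f g, E f -> Hinf g -> aeeq f g -> E g)].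

Definition proper_Hinf (E : set (R -> R[i])) : Prop :=
  exists g, Hinf g /\ ~ E g.

(* weak-star closed for the duality H^infty = (L^1/H^1_0)^*, whose pairing is
   <f, phi + H^1_0> = \int f phi dm: the complement of E in H^infty is open for
   the topology generated by the seminorms f |-> |\int f phi dm|, phi in L^1. *)
Definition weakstar_closed (E : set (R -> R[i])) : Prop :=
  forall g, Hinf g -> ~ E g ->
    exists (n : nat) (phi : 'I_n -> R -> R[i]) (eps : R),
      [/\ 0 < eps, (forall i, L1 (phi i)) &
          forall e, E e -> exists i : 'I_n,
            eps <= cabs (cint (fun t => (e t - g t) * phi i t))].

Definition qnorm (E : set (R -> R[i])) (f : R -> R[i]) : R :=
  inf [set normInf (fun t => f t + e t) | e in E].

Definition extreme_coset (E : set (R -> R[i])) (f : R -> R[i]) : Prop :=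
  qnorm E f <= 1 /\
  forall g k, Hinf g -> Hinf k -> qnorm E g <= 1 -> qnorm E k <= 1 ->
    E (fun t => f t - (g t + k t) / 2%:R) ->
    E (fun t => g t - k t).

(* M(f; H^infty, E) = {h}  (as a set of elements of H^infty, i.e. up to a.e.) *)
Definition best_approx_unique (E : set (R -> R[i])) (f h : R -> R[i]) : Prop :=
  [/\ Hinf h, E (fun t => h t - f t), normInf h = qnorm E f &
      forall xi, Hinf xi -> E (fun t => xi t - f t) -> normInf xi = qnorm E f ->
        aeeq xi h].

(* log(1 - |h|) as an extended-real-valued function (log 0 = -oo) *)
Definition log1m_abs (h : R -> R[i]) (t : R) : \bar R :=
  if cabs (h t) < 1 then (ln (1 - cabs (h t)))%:E else -oo%E.

Definition log1m_abs_L1 (h : R -> R[i]) : Prop :=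
  leb.-integrable circ (log1m_abs h).

End Defs.

(* Main.v *)
Require Import Defs.
From HB Require Import structures.
From mathcomp Require Import all_boot all_order all_algebra.
From mathcomp Require Import complex.
From mathcomp Require Import all_classical all_reals all_analysis.
From mathcomp Require Import measurable_realfun.
From mathcomp Require Import ring lra.
Set Implicit Arguments.
Unset Strict Implicit.
Unset Printing Implicit Defensive.
Import Order.TTheory GRing.Theory Num.Theory.
Import numFieldNormedType.Exports.
Local Open Scope classical_set_scope.
Local Open Scope ring_scope.

(** A coset of norm at most 1 contains a function of norm at most 1: near-optimal
    representatives are bounded in L^2, so suitable convex combinations of them converge
    almost everywhere and boundedly, hence weak-star.

    If |h + g| <= 1 and |h - g| <= 1 with g <> 0 in H^infty, the parallelogram law gives
    |g|^2 <= 2 (1 - |h|), and log |g| is integrable, hence so is log (1 - |h|).  Conversely,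
    if log (1 - |h|) is integrable, the outer functions of modulus at most a multiple of
    1 - |h| have all of H^infty as the weak-star closed ideal they generate; so if h + E were
    extreme with such a norm-one representative h, every G in H^infty with |G| <= 1 - |h|
    would lie in E (as h + E is the midpoint of h + G + E and h - G + E), and E = H^infty.

    Outer functions are obtained without boundary values of harmonic conjugates: for a
    trigonometric polynomial p = Re P the functions (1 + P / k) ^ k do the job up to a small
    error, and the general case follows by approximation and convex combinations.  The
    integrability of log |g| is deduced from the same outer functions: if |u| <= 1 / max(|g|, d)
    is outer then |int u| |int g| = |int (u g)| <= 1. *)

(** * Real integrals on the circle *)

(** Outerness never appears as such. A function [v] that plays the outer function of modulus exp q
    is only asked to satisfy |v| <= exp q and Re (mean of v) >= exp (mean of q). By Jensen's
    inequality such a pair of bounds is tight, and, unlike an equality of moduli, each bound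
    survives midpoints and limits. This matters because the compactness in use is Mazur's: limits
    are taken of iterated midpoints, so every property carried along (bound on the modulus,
    membership in a coset of [E], being a multiplier, mean in a half-plane) has to be
    midpoint-convex.

    The mean also explains why multiples of 1 - |h| suffice to recover all of H^infty: if log (1 -
    |h|) is integrable, there are such v_k with |v_k| <= min (1, (k + 1)(1 - |h|)) and means tending
    to 1. A limit has modulus at most 1 and mean 1, hence is the constant 1.

    The power (1 + P / k) ^ k replaces exp P because it is a polynomial in P: it stays among the
    multipliers and its mean is exactly (1 + c / k) ^ k, with c the mean of P. *)

Section RealIntegrals.
Variable R : realType.
Implicit Types (f g : R -> R) (P Q : R -> Prop).
Local Notation mu := (@leb R).
Local Notation D := (@circ R).

#[export] Instance ae_leb_filter : Filter (nbhs (almost_everywhere mu)).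
Proof. exact: (@ae_filter_ringOfSetsType _ _ _ (@lebesgue_measure R)). Qed.

Definition aec P := {ae mu, forall t, D t -> P t}.
Definition mfun f := measurable_fun D f.
Definition Rintegrable f := mu.-integrable D (EFin \o f).
Definition rint f : R := Rintegral mu D f.

Lemma cvgn_le (u : nat -> R) (l M : R) : u @ \oo --> l ->
  (\forall n \near \oo, u n <= M) -> l <= M.
Proof.
move=> ul uM; rewrite -(cvg_lim _ ul)//.
by apply: limr_le => //; apply/cvg_ex; exists l.
Qed.

Lemma cvgn_ge (u : nat -> R) (l M : R) : u @ \oo --> l ->
  (\forall n \near \oo, M <= u n) -> M <= l.
Proof.
move=> ul uM; rewrite -(cvg_lim _ ul)//.
by apply: limr_ge => //; apply/cvg_ex; exists l.
Qed.

Lemma cvgn0_lt (u : nat -> R) (e : R) : u @ \oo --> 0 -> 0 < e ->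
  exists N, forall n, (N <= n)%N -> `|u n| < e.
Proof.
move=> /cvgrPdist_lt u0 /u0[N _ h]; exists N => n Nn.
by have := h n Nn; rewrite sub0r normrN.
Qed.

Lemma cvg_half_exp : 2^-1 ^+ n @[n --> \oo] --> (0 : R).
Proof.
have h : `|2^-1 : R| < 1 by rewrite ger0_norm; lra.
have := cvg_geometric 1 h.
by rewrite (_ : geometric 1 2^-1 = (fun n => 2^-1 ^+ n))//; apply/funext => n; rewrite /= mul1r.
Qed.

Lemma measurable_circ : measurable D.
Proof. exact: measurable_itv. Qed.

(* The same fact for the measurable structure on which [lebesgue_measure] is declared. *)
Lemma lmeasurable_circ : measurable (D : set (measurableTypeR R)).
Proof. exact: measurable_circ. Qed.

Lemma leb_circ : mu D = 1%:E.
Proof. by rewrite /leb /circ lebesgue_measure_itv /= lte_fin ltr01 sube0. Qed.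

Lemma aecW P : (forall t, D t -> P t) -> aec P.
Proof. by move=> h; exact: aeW. Qed.

Lemma aecS P Q : (forall t, D t -> P t -> Q t) -> aec P -> aec Q.
Proof. by move=> h; rewrite /aec; apply: filterS => t hP Dt; apply: h (Dt) (hP Dt). Qed.

Lemma aecI P Q : aec P -> aec Q -> aec (fun t => P t /\ Q t).
Proof. by rewrite /aec; apply: filterS2 => t hP hQ Dt; split; [exact: hP|exact: hQ]. Qed.

Lemma aec_forall (P : nat -> R -> Prop) :
  (forall n, aec (P n)) -> aec (fun t => forall n, P n t).
Proof.
by rewrite /aec => h; have := ae_foralln h; apply: filterS => t H Dt n; exact: H.
Qed.

Lemma Rintegrable_mfun f : Rintegrable f -> mfun f.
Proof.
move=> /integrableP[+ _]; rewrite /mfun => h.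
exact/measurable_EFinP.
Qed.

Lemma Rintegrable_le f g : mfun f -> Rintegrable g -> aec (fun t => `|f t| <= g t) -> Rintegrable f.
Proof.
move=> mf Ig fg; apply/integrableP; split; first exact/measurable_EFinP.
have mg := Rintegrable_mfun Ig.
move/integrableP: Ig => [_]; apply: le_lt_trans.
apply: ae_ge0_le_integral => //.
- exact: measurable_circ.
- by apply: measurableT_comp => //; exact/measurable_EFinP.
- by apply: measurableT_comp => //; exact/measurable_EFinP.
- apply: (aecS _ fg) => t _ h /=.
  by rewrite lee_fin (le_trans h)// ler_norm.
Qed.

Lemma Rintegrable_cst (c : R) : Rintegrable (fun=> c).
Proof.
apply: (@measurable_bounded_integrable _ _ _ mu) => //=.
- exact: measurable_circ.
- by have : (mu D < +oo)%E by rewrite leb_circ ltry.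
- exists `|c|; split; first exact: num_real.
  by move=> x cx t _ /=; apply: ltW.
Qed.

Lemma rint_cst (c : R) : rint (fun=> c) = c.
Proof.
rewrite /rint Rintegral_cst; last exact: measurable_circ.
by rewrite [X in fine X]leb_circ mulr1.
Qed.

Lemma Rintegrable_bdd f (M : R) : mfun f -> aec (fun t => `|f t| <= M) -> Rintegrable f.
Proof. by move=> mf; apply: Rintegrable_le => //; exact: Rintegrable_cst. Qed.

Lemma RintegrableD f g : Rintegrable f -> Rintegrable g -> Rintegrable (fun t => f t + g t).
Proof. by move=> If Ig; have := integrableD lmeasurable_circ If Ig. Qed.

Lemma RintegrableZ (c : R) f : Rintegrable f -> Rintegrable (fun t => c * f t).
Proof. by move=> If; have := integrableZl lmeasurable_circ c If. Qed.

Lemma RintegrableB f g : Rintegrable f -> Rintegrable g -> Rintegrable (fun t => f t - g t).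
Proof. by move=> If Ig; have := integrableB lmeasurable_circ If Ig. Qed.

Lemma Rintegrable_abs f : Rintegrable f -> Rintegrable (fun t => `|f t|).
Proof. by move=> If; have := integrable_abse If. Qed.

Lemma rintD f g : Rintegrable f -> Rintegrable g -> rint (fun t => f t + g t) = rint f + rint g.
Proof. by move=> If Ig; rewrite /rint RintegralD//; exact: measurable_circ. Qed.

Lemma rintB f g : Rintegrable f -> Rintegrable g -> rint (fun t => f t - g t) = rint f - rint g.
Proof. by move=> If Ig; rewrite /rint RintegralB//; exact: measurable_circ. Qed.

Lemma rintZ (c : R) f : Rintegrable f -> rint (fun t => c * f t) = c * rint f.
Proof. by move=> If; rewrite /rint RintegralZl//; exact: measurable_circ. Qed.

Lemma le_rint_abs f : Rintegrable f -> `|rint f| <= rint (fun t => `|f t|).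
Proof. by move=> If; apply: le_normr_Rintegral => //; exact: measurable_circ. Qed.

Lemma eq_rint_ae f g : mfun f -> mfun g -> aec (fun t => f t = g t) ->
  rint f = rint g.
Proof.
move=> mf mg fg; rewrite /rint /Rintegral; congr fine.
apply: ae_eq_integral.
- exact: measurable_circ.
- exact/measurable_EFinP.
- exact/measurable_EFinP.
- by apply: (aecS _ fg) => t _ /= ->.
Qed.

Lemma eq_rint f g : (forall t, D t -> f t = g t) -> rint f = rint g.
Proof. by move=> fg; apply: eq_Rintegral => t; rewrite inE => Dt; exact: fg. Qed.

Lemma rint_ge0 f : mfun f -> aec (fun t => 0 <= f t) -> 0 <= rint f.
Proof.
move=> mf f0.
rewrite (@eq_rint_ae f (fun t => `|f t|)) //.
- by apply: Rintegral_ge0 => t _.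
- exact: measurableT_comp.
- by apply: aecS f0 => t _ h; rewrite ger0_norm.
Qed.

Lemma le_rint f g : Rintegrable f -> Rintegrable g -> aec (fun t => f t <= g t) ->
  rint f <= rint g.
Proof.
move=> If Ig fg; rewrite -subr_ge0 -rintB//.
apply: rint_ge0; first by apply: Rintegrable_mfun; exact: RintegrableB.
by apply: aecS fg => t _; rewrite subr_ge0.
Qed.

Lemma rint_eq0 f : Rintegrable f -> aec (fun t => 0 <= f t) -> rint f <= 0 ->
  aec (fun t => f t = 0).
Proof.
move=> If f0 fle.
have mf := Rintegrable_mfun If.
have mEf : measurable_fun D (EFin \o f) by exact/measurable_EFinP.
have : (\int[mu]_(t in D) `|(f t)%:E|)%E = 0.
  have fi := @integrable_fin_num _ _ _ _ _ lmeasurable_circ _ (integrable_abse If).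
  rewrite /= -[LHS]fineK//; congr EFin; apply/eqP; rewrite eq_le.
  apply/andP; split; last first.
    by apply: fine_ge0; apply: integral_ge0 => t _ /=; rewrite lee_fin.
  apply: le_trans fle.
  rewrite (@eq_rint_ae f (fun t => `|f t|)) //; last 2 first.
  - exact: measurableT_comp.
  - by apply: aecS f0 => t _ h; rewrite ger0_norm.
move/(ae_eq_integral_abs mu lmeasurable_circ mEf).
by apply: filterS => t h Dt; have [] := h Dt.
Qed.

Lemma rint_dct (f_ : nat -> R -> R) f g :
  (forall n, mfun (f_ n)) -> mfun f -> Rintegrable g ->
  aec (fun t => f_ ^~ t @ \oo --> f t) ->
  aec (fun t => forall n, `|f_ n t| <= g t) ->
  rint (f_ n) @[n --> \oo] --> rint f.
Proof.
move=> mf_ mf Ig cf fg.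
have h1 n : measurable_fun D (EFin \o f_ n) by apply/measurable_EFinP; exact: mf_.
have h2 : measurable_fun D (EFin \o f) by exact/measurable_EFinP.
have h3 : {ae mu, forall t, D t -> (fun n => (f_ n t)%:E) @ \oo --> (f t)%:E}.
  by apply: (aecS _ cf) => t _ h; apply: cvg_EFin; [exact: nearW|exact: h].
have h4 : {ae mu, forall t n, D t -> (`|(f_ n t)%:E| <= (g t)%:E)%E}.
  by move: fg; rewrite /aec; apply: filterS => t h n Dt; rewrite lee_fin; exact: h.
have [If _] := @dominated_convergence _ _ R lebesgue_measure D lmeasurable_circ
  (fun n => EFin \o f_ n) (EFin \o f) (EFin \o g) h1 h2 h3 Ig h4.
rewrite /rint /Rintegral => h.
apply: fine_cvg; rewrite fineK//.
exact: (integrable_fin_num lmeasurable_circ If).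
Qed.

(** Summing the integrals term by term shows that the sum of the series is integrable, hence finite
    almost everywhere. Geometric rates in L^1 thus give a.e. convergence without extracting
    subsequences. *)
Lemma summable_ae (f_ : nat -> R -> R) (C : R) :
  (forall n, Rintegrable (f_ n)) -> (forall n t, D t -> 0 <= f_ n t) ->
  (forall n, rint (f_ n) <= C * 2^-1 ^+ n) ->
  aec (fun t => cvgn (series (f_ ^~ t))).
Proof.
move=> If f0 fle.
have mf n : measurable_fun D (EFin \o f_ n) by apply/measurable_EFinP; exact: Rintegrable_mfun.
have f0' n t : D t -> (0 <= (EFin \o f_ n) t)%E by move=> Dt; rewrite lee_fin f0.
pose F t := (\sum_(0 <= n <oo) (EFin \o f_ n) t)%E.
have IF : mu.-integrable D F.
  apply/integrableP; split.
    by apply: (@ge0_emeasurable_sum _ _ _ D (fun n => EFin \o f_ n) xpredT)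
      => // n t Dt _; exact: f0'.
  rewrite (_ : (\int[mu]_(x in D) _)%E = (\int[mu]_(x in D) F x)%E); last first.
    apply: eq_integral => t; rewrite inE => Dt; rewrite gee0_abs//.
    by apply: nneseries_ge0 => n _ _; exact: f0'.
  rewrite /F integral_nneseries//; last exact: measurable_circ.
  have C0 : 0 <= C.
    by have := fle 0%N; rewrite expr0 mulr1; apply: le_trans; apply: Rintegral_ge0 => t; exact: f0.
  apply: (@le_lt_trans _ _ (\sum_(0 <= n <oo) (C * 2^-1 ^+ n)%:E)%E).
    apply: lee_nneseries => n _.
      by move=> _; apply: integral_ge0 => t Dt; exact: f0'.
    have fi := integrable_fin_num lmeasurable_circ (If n).
    by rewrite -[leLHS]fineK// lee_fin; exact: fle.
  apply: (@le_lt_trans _ _ (C * 2)%:E); last exact: ltry.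
  apply: lime_le.
    by apply: is_cvg_nneseries => n _ _; rewrite lee_fin mulr_ge0 ?exprn_ge0 ?invr_ge0.
  apply: nearW => n; rewrite sumEFin lee_fin.
  have h1 : `|2^-1 : R| < 1 by rewrite ger0_norm; lra.
  have := @geometric_le_lim R n C 2^-1 C0 (ltac:(lra)) h1.
  by rewrite (_ : (1 - 2^-1)^-1 = 2 :> R); [|field].
have := integrable_ae lmeasurable_circ IF; rewrite /aec.
apply: filterS => t h Dt; have {}h := h Dt.
apply: nondecreasing_is_cvgn.
  by apply/nondecreasing_series => n _ _; exact: f0.
exists (fine (F t)) => _ [n _ <-].
rewrite -lee_fin fineK// /series /= -sumEFin.
by apply: nneseries_lim_ge => k _ _; exact: f0'.
Qed.

End RealIntegrals.

(** * Complex-valued functions *)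

Section ComplexIntegrals.
Variable R : realType.
Local Notation Re := complex.Re.
Local Notation Im := complex.Im.
Implicit Types (z w : R[i]) (f g u v phi : R -> R[i]).

Lemma ReD z w : Re (z + w) = Re z + Re w. Proof. by case: z; case: w. Qed.
Lemma ImD z w : Im (z + w) = Im z + Im w. Proof. by case: z; case: w. Qed.
Lemma ReN z : Re (- z) = - Re z. Proof. by case: z. Qed.
Lemma ImN z : Im (- z) = - Im z. Proof. by case: z. Qed.
Lemma ReM z w : Re (z * w) = Re z * Re w - Im z * Im w.
Proof. by case: z; case: w. Qed.
Lemma ImM z w : Im (z * w) = Re z * Im w + Im z * Re w.
Proof. by case: z; case: w. Qed.
Lemma ReJ z : Re (conjc z) = Re z. Proof. by case: z. Qed.
Lemma ImJ z : Im (conjc z) = - Im z. Proof. by case: z. Qed.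
Lemma ReX (a b : R) : Re (Complex a b) = a. Proof. by []. Qed.
Lemma ImX (a b : R) : Im (Complex a b) = b. Proof. by []. Qed.
Lemma Re1 : Re (1 : R[i]) = 1. Proof. by []. Qed.
Lemma Im1 : Im (1 : R[i]) = 0. Proof. by []. Qed.
Lemma Re0 : Re (0 : R[i]) = 0. Proof. by []. Qed.
Lemma Im0 : Im (0 : R[i]) = 0. Proof. by []. Qed.

Definition ReImE := (ReD, ImD, ReN, ImN, ReM, ImM, ReJ, ImJ, ReX, ImX, Re1, Im1, Re0, Im0).

Lemma complexP z w : Re z = Re w -> Im z = Im w -> z = w.
Proof. by case: z => a b; case: w => c d /= -> ->. Qed.

Lemma invn_complex n : ((n%:R)^-1 : R[i]) = Complex n%:R^-1 0.
Proof. by rewrite -[RHS]/(real_complex R n%:R^-1) fmorphV rmorph_nat. Qed.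

Lemma cabsE z : cabs z = ComplexField.Normc.normc z. Proof. by case: z. Qed.
Lemma cabs_ge0 z : 0 <= cabs z. Proof. exact: sqrtr_ge0. Qed.
Lemma cabs_sqr z : cabs z ^+ 2 = Re z ^+ 2 + Im z ^+ 2.
Proof. by rewrite sqr_sqrtr// addr_ge0 ?sqr_ge0. Qed.
Lemma cabsM z w : cabs (z * w) = cabs z * cabs w.
Proof. by rewrite !cabsE ComplexField.Normc.normcM. Qed.
Lemma cabsD z w : cabs (z + w) <= cabs z + cabs w.
Proof. by rewrite !cabsE le_normcD. Qed.
Lemma cabsN z : cabs (- z) = cabs z.
Proof. by rewrite !cabsE normcN. Qed.
Lemma cabs_real (a : R) : cabs (Complex a 0) = `|a|.
Proof. by rewrite /cabs /= expr0n addr0 sqrtr_sqr. Qed.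
Lemma cabs0 : cabs (0 : R[i]) = 0.
Proof. by rewrite (cabs_real 0) normr0. Qed.
Lemma cabs_eq0 z : cabs z = 0 -> z = 0.
Proof. by rewrite cabsE => /ComplexField.Normc.eq0_normc. Qed.
Lemma cabsX z n : cabs (z ^+ n) = cabs z ^+ n.
Proof.
elim: n => [|n ih]; first by rewrite !expr0 (cabs_real 1) normr1.
by rewrite !exprS cabsM ih.
Qed.
Lemma Re_cabs z : `|Re z| <= cabs z.
Proof. by rewrite /cabs -sqrtr_sqr ler_wsqrtr// lerDl sqr_ge0. Qed.
Lemma Im_cabs z : `|Im z| <= cabs z.
Proof. by rewrite /cabs -sqrtr_sqr ler_wsqrtr// lerDr sqr_ge0. Qed.
Lemma cabs_leD z : cabs z <= `|Re z| + `|Im z|.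
Proof.
rewrite {1}[z](_ : _ = Complex (Re z) 0 + Complex 0 1 * Complex (Im z) 0).
  apply: le_trans (cabsD _ _) _; rewrite cabsM !cabs_real.
  by rewrite {1}/cabs /= expr0n add0r expr1n sqrtr1 mul1r.
by apply: complexP; rewrite !ReImE; ring.
Qed.
Lemma cabs_le2 z (M : R) : `|Re z| <= M -> `|Im z| <= M -> cabs z <= 2 * M.
Proof. by have := cabs_leD z; lra. Qed.

Definition ccvg (z : nat -> R[i]) w :=
  (Re (z n) @[n --> \oo] --> Re w) /\ (Im (z n) @[n --> \oo] --> Im w).

Lemma ccvg_cabs (z_ : nat -> R[i]) w : ccvg z_ w -> cabs (z_ n) @[n --> \oo] --> cabs w.
Proof.
move=> [h1 h2]; rewrite /cabs.
apply: (@cvg_comp _ _ _ (fun n => Re (z_ n) ^+ 2 + Im (z_ n) ^+ 2) Num.sqrt); last first.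
  exact: sqrt_continuous.
by apply: cvgD; apply: (cvg_comp _ (fun x : R => x ^+ 2)); first exact: h1;
  [exact: exprn_continuous|exact: h2|exact: exprn_continuous].
Qed.

Lemma ccvg_unique (z_ : nat -> R[i]) w w' : ccvg z_ w -> ccvg z_ w' -> w = w'.
Proof.
move=> [h1 h2] [h1' h2']; apply: complexP.
  by rewrite -(cvg_lim _ h1)// -(cvg_lim _ h1').
by rewrite -(cvg_lim _ h2)// -(cvg_lim _ h2').
Qed.

Lemma ccvg_cst w : ccvg (fun=> w) w.
Proof. by split; exact: cvg_cst. Qed.

Lemma ccvgD (z_ z'_ : nat -> R[i]) z z' :
  ccvg z_ z -> ccvg z'_ z' -> ccvg (fun n => z_ n + z'_ n) (z + z').
Proof.
move=> [h1 h2] [h1' h2']; split; rewrite ReImE.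
  by under eq_fun do rewrite ReImE; exact: cvgD.
by under eq_fun do rewrite ReImE; exact: cvgD.
Qed.

Lemma ccvgM (z_ z'_ : nat -> R[i]) z z' :
  ccvg z_ z -> ccvg z'_ z' -> ccvg (fun n => z_ n * z'_ n) (z * z').
Proof.
move=> [h1 h2] [h1' h2']; split; rewrite ReImE.
  by under eq_fun do rewrite ReImE; apply: cvgB; exact: cvgM.
by under eq_fun do rewrite ReImE; apply: cvgD; exact: cvgM.
Qed.

Lemma cmeas_cst (c : R[i]) : cmeas (fun=> c).
Proof. by split; exact: measurable_cst. Qed.

Lemma cmeasD f g : cmeas f -> cmeas g -> cmeas (fun t => f t + g t).
Proof.
move=> [h1 h2] [h1' h2']; split; under eq_fun do rewrite ReImE; exact: measurable_funD.
Qed.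

Lemma cmeasM f g : cmeas f -> cmeas g -> cmeas (fun t => f t * g t).
Proof.
move=> [h1 h2] [h1' h2']; split; under eq_fun do rewrite ReImE.
  by apply: measurable_funB; exact: measurable_funM.
by apply: measurable_funD; exact: measurable_funM.
Qed.

Lemma mfun_cabs f : cmeas f -> mfun (fun t => cabs (f t)).
Proof.
move=> [h1 h2]; rewrite /mfun /cabs.
apply: (@measurableT_comp _ _ _ _ _ _ (@Num.sqrt R) _ (fun t => Re (f t) ^+ 2 + Im (f t) ^+ 2)).
  by apply: continuous_measurable_fun; exact: sqrt_continuous.
by apply: measurable_funD; exact: measurable_funX.
Qed.

Lemma cmeas_L1 f (M : R) : cmeas f -> aec (fun t => cabs (f t) <= M) -> L1 f.
Proof.
move=> [h1 h2] fM; split.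
  by apply: (Rintegrable_bdd (M := M)) => //; apply: aecS fM => t _; apply: le_trans (Re_cabs _).
by apply: (Rintegrable_bdd (M := M)) => //; apply: aecS fM => t _; apply: le_trans (Im_cabs _).
Qed.

Lemma Linf_L1 f : Linf f -> L1 f.
Proof. by move=> [mf [M fM]]; apply: (cmeas_L1 (M := M)). Qed.

Lemma L1_cmeas f : L1 f -> cmeas f.
Proof. by move=> [h1 h2]; split; exact: Rintegrable_mfun. Qed.

Lemma L1_cabs f : L1 f -> Rintegrable (fun t => cabs (f t)).
Proof.
move=> fL; have [h1 h2] := fL.
apply: (Rintegrable_le (g := fun t => `|Re (f t)| + `|Im (f t)|)).
- by apply: mfun_cabs; exact: L1_cmeas.
- by apply: RintegrableD; exact: Rintegrable_abs.
- apply: aecW => t _; rewrite ger0_norm ?cabs_ge0//.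
  exact: cabs_leD.
Qed.

Lemma LinfM_L1 u phi : Linf u -> L1 phi -> L1 (fun t => u t * phi t).
Proof.
move=> [mu_ [M uM]] Lphi; have mp := L1_cmeas Lphi.
have [m1 m2] := cmeasM mu_ mp.
have IM : Rintegrable (fun t => M * cabs (phi t)) by apply: RintegrableZ; exact: L1_cabs.
by split; (apply: Rintegrable_le IM _ => //; apply: aecS uM => t _ h;
  (apply: le_trans; [exact: Re_cabs || exact: Im_cabs|]);
  rewrite cabsM ler_wpM2r ?cabs_ge0).
Qed.

Lemma Linf_cst (c : R[i]) : Linf (fun=> c).
Proof. by split; [exact: cmeas_cst|exists (cabs c); exact: aecW]. Qed.

Lemma LinfD f g : Linf f -> Linf g -> Linf (fun t => f t + g t).
Proof.
move=> [mf [M fM]] [mg [N gN]]; split; first exact: cmeasD.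
exists (M + N); apply: aecS (aecI fM gN) => t _ [h1 h2].
by apply: le_trans (cabsD _ _) _; exact: lerD.
Qed.

Lemma LinfM f g : Linf f -> Linf g -> Linf (fun t => f t * g t).
Proof.
move=> [mf [M fM]] [mg [N gN]]; split; first exact: cmeasM.
exists (M * N); apply: aecS (aecI fM gN) => t _ [h1 h2].
by rewrite cabsM; apply: ler_pM; rewrite ?cabs_ge0.
Qed.

Lemma cintD f g : L1 f -> L1 g -> cint (fun t => f t + g t) = cint f + cint g.
Proof.
move=> [h1 h2] [h1' h2']; apply: complexP; rewrite (ReD, ImD) /= -!/(rint _).
  by rewrite -rintD//; apply: eq_rint => t _; rewrite ReImE.
by rewrite -rintD//; apply: eq_rint => t _; rewrite ReImE.
Qed.

Lemma cintZ (c : R[i]) f : L1 f -> cint (fun t => c * f t) = c * cint f.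
Proof.
move=> [h1 h2]; apply: complexP.
  rewrite ReM /= -/(rint _) -/(rint _) -/(rint _) -!rintZ// -rintB; try exact: RintegrableZ.
  by apply: eq_rint => t _; rewrite ReM.
rewrite ImM /= -/(rint _) -/(rint _) -/(rint _) -!rintZ// -rintD; try exact: RintegrableZ.
by apply: eq_rint => t _; rewrite ImM.
Qed.

Lemma eq_cint f g : (forall t, f t = g t) -> cint f = cint g.
Proof. by move=> h; congr cint; apply/funext. Qed.

(** The factor 2 comes from bounding real and imaginary parts separately; it is absorbed by the
    constant of [log_majorant_bound]. *)
Lemma cint_le2 f (M : R) : cmeas f -> aec (fun t => cabs (f t) <= M) -> cabs (cint f) <= 2 * M.
Proof.
move=> mf fM; have [h1 h2] := cmeas_L1 mf fM.
by apply: cabs_le2 => /=; (apply: le_trans; [exact: le_rint_abs|]);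
 rewrite -[leRHS]rint_cst; apply: le_rint;
 [exact: Rintegrable_abs|exact: Rintegrable_cst| |exact: Rintegrable_abs|exact: Rintegrable_cst|];
 apply: aecS fM => t _; apply: le_trans; [exact: Re_cabs|exact: Im_cabs].
Qed.

(** Domination by [M * cabs (phi t)]. This is the bridge from bounded a.e. convergence to weak-star
    convergence. *)
Lemma cint_dct (u_ : nat -> R -> R[i]) u phi (M : R) :
  (forall n, cmeas (u_ n)) -> cmeas u -> L1 phi ->
  aec (fun t => forall n, cabs (u_ n t) <= M) ->
  aec (fun t => ccvg (u_ ^~ t) (u t)) ->
  ccvg (fun n => cint (fun t => u_ n t * phi t)) (cint (fun t => u t * phi t)).
Proof.
move=> mu_ mu0 Lphi uM cu; have mp := L1_cmeas Lphi.
have IM : Rintegrable (fun t => M * cabs (phi t)) by apply: RintegrableZ; exact: L1_cabs.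
have m1 n := cmeasM (mu_ n) mp; have m2 := cmeasM mu0 mp.
have cv : aec (fun t => ccvg (fun n => u_ n t * phi t) (u t * phi t)).
  by apply: aecS cu => t _ h; apply: ccvgM => //; exact: ccvg_cst.
split; rewrite /=; (apply: rint_dct IM _ _;
  [by move=> n; have [] := m1 n|by have [] := m2| |]).
- by apply: aecS cv => t _ [].
- apply: aecS uM => t _ h n; apply: le_trans (Re_cabs _) _.
  by rewrite cabsM ler_wpM2r ?cabs_ge0.
- by apply: aecS cv => t _ [].
- apply: aecS uM => t _ h n; apply: le_trans (Im_cabs _) _.
  by rewrite cabsM ler_wpM2r ?cabs_ge0.
Qed.

End ComplexIntegrals.

(** * Almost everywhere convergent convex combinations *)

Section Mazur.
Variable R : realType.
Local Notation D := (@circ R).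
Local Notation Re := complex.Re.
Local Notation Im := complex.Im.
Local Notation F := (R -> R[i]).

Lemma mfun_lim (h : nat -> R -> R) : (forall n, mfun (h n)) ->
  aec (fun t => cvgn (h ^~ t)) ->
  exists g, mfun g /\ aec (fun t => h ^~ t @ \oo --> g t).
Proof.
move=> mh [A [mA A0 subA]].
(* Zeroing the sequence on the exceptional null set makes it converge everywhere on the circle, so
   that its limit is measurable. *)
pose h' n t := h n t * \1_(~` A) t.
pose g t := limn (h' ^~ t).
have ch t : D t -> h' ^~ t @ \oo --> g t.
  move=> Dt; apply/cvg_ex; have [At|At] := pselect (A t).
    exists 0; rewrite /h' indicE memNset; last by move=> /(_ At).
    by under eq_fun do rewrite mulr0; exact: cvg_cst.
  have : cvgn (h ^~ t) by apply: contrapT => nc; apply/At/subA => /(_ Dt).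
  move=> /cvg_ex[l hl]; exists l; rewrite /h' indicE mem_set//.
  by under eq_fun do rewrite mulr1.
exists g; split.
  apply: (@measurable_fun_cvg _ _ _ D h') => // n.
  apply: measurable_funM; first exact: mh.
  by apply: measurable_indic; apply: measurableC.
exists A; split => // t /=; apply: contra_notP => At Dt.
have := ch _ Dt; rewrite /h' indicE mem_set//.
by under eq_fun do rewrite mulr1.
Qed.

Lemma cmeas_lim (u : nat -> F) : (forall n, cmeas (u n)) ->
  aec (fun t => cvgn (fun n => Re (u n t)) /\ cvgn (fun n => Im (u n t))) ->
  exists w, cmeas w /\ aec (fun t => ccvg (u ^~ t) (w t)).
Proof.
move=> mu_ cu.
have [g1 [mg1 cg1]] : exists g, mfun g /\
    aec (fun t => (fun n => Re (u n t)) @ \oo --> g t).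
  apply: (@mfun_lim (fun n t => Re (u n t))); first by move=> n; have [] := mu_ n.
  by apply: aecS cu => t _ [].
have [g2 [mg2 cg2]] : exists g, mfun g /\
    aec (fun t => (fun n => Im (u n t)) @ \oo --> g t).
  apply: (@mfun_lim (fun n t => Im (u n t))); first by move=> n; have [] := mu_ n.
  by apply: aecS cu => t _ [].
exists (fun t => Complex (g1 t) (g2 t)); split; first by split.
by apply: aecS (aecI cg1 cg2) => t _ [].
Qed.

Definition midconvex (S : set F) :=
  forall a b, S a -> S b -> S (fun t => (a t + b t) / 2%:R).

(** The dyadic convex combinations of the tail from [n], encoded as an intersection: a
    midpoint-convex property of the tail passes to the hull by mere application, without
    coefficients. *)
Definition hull (v : nat -> F) (n : nat) : set F :=
  [set w | forall S, midconvex S -> (forall m, (n <= m)%N -> S (v m)) -> S w].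

Lemma hull_mid v n : midconvex (hull v n).
Proof.
by move=> a b ha hb S mS vS; apply: (mS); [exact: ha|exact: hb].
Qed.

Lemma hull_self v n : hull v n (v n).
Proof. by move=> S _; apply. Qed.

Lemma hull_le v m n : (m <= n)%N -> hull v n `<=` hull v m.
Proof.
by move=> mn w h S mS vS; apply: h => // k nk; apply: vS; exact: leq_trans nk.
Qed.

Lemma half_complex (z : R[i]) : z / 2%:R = Complex (Re z / 2) (Im z / 2).
Proof. by rewrite (invn_complex R 2); apply: complexP; rewrite !ReImE; ring. Qed.

Lemma cabs_half (z : R[i]) : cabs (z / 2%:R) = cabs z / 2.
Proof. by rewrite (invn_complex R 2) cabsM cabs_real ger0_norm. Qed.

Lemma cabs_mid (a b : R[i]) (M : R) : cabs a <= M -> cabs b <= M ->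
  cabs ((a + b) / 2%:R) <= M.
Proof. by move=> h1 h2; rewrite cabs_half; have := cabsD a b; lra. Qed.

Lemma midconvex_bdd (M : R) :
  midconvex (fun f => cmeas f /\ aec (fun t => cabs (f t) <= M)).
Proof.
move=> a b [ma aM] [mb bM]; split.
  by apply: cmeasM; [exact: cmeasD|exact: cmeas_cst].
by apply: aecS (aecI aM bM) => t _ [h1 h2]; exact: cabs_mid.
Qed.

Lemma parallelogram (a b : R[i]) : cabs (a - b) ^+ 2 =
  2 * cabs a ^+ 2 + 2 * cabs b ^+ 2 - 4 * cabs ((a + b) / 2%:R) ^+ 2.
Proof. by rewrite half_complex !cabs_sqr !ReImE /=; field. Qed.

(* The points of the tail hulls of nearly minimal L^2 norm form, by the parallelogram law,
   a Cauchy sequence; made fast enough it converges a.e. *)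
Lemma mazur (v : nat -> F) (M : R) :
  (forall n, cmeas (v n)) -> (forall n, aec (fun t => cabs (v n t) <= M)) ->
  exists (u : nat -> F) (w : F),
    [/\ forall n, hull v n (u n), cmeas w & aec (fun t => ccvg (u ^~ t) (w t))].
Proof.
move=> mv vM.
pose N (f : F) := rint (fun t => cabs (f t) ^+ 2).
have hB n w : hull v n w -> cmeas w /\ aec (fun t => cabs (w t) <= M).
  by move/(_ _ (@midconvex_bdd M)); apply => m _.
have IN (w : F) K : cmeas w -> aec (fun t => cabs (w t) <= K) ->
    Rintegrable (fun t => cabs (w t) ^+ 2).
  move=> mw wK; apply: (Rintegrable_bdd (M := K ^+ 2)).
    by apply: measurable_funX; exact: mfun_cabs.
  apply: aecS wK => t _ h; rewrite ger0_norm ?sqr_ge0// ler_sqr ?nnegrE ?cabs_ge0//.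
  exact: le_trans (cabs_ge0 _) h.
have N0 w : 0 <= N w by apply: Rintegral_ge0 => t _; exact: sqr_ge0.
have NM n w : hull v n w -> N w <= M ^+ 2.
  move=> /hB[mw wM]; rewrite -[leRHS]rint_cst.
  apply: le_rint; [exact: IN wM|exact: Rintegrable_cst|].
  apply: aecS wM => t _ h; rewrite ler_sqr ?nnegrE ?cabs_ge0//.
  exact: le_trans (cabs_ge0 _) h.
pose d n := inf [set N w | w in hull v n].
have lb n : has_lbound [set N w | w in hull v n] by exists 0 => _ [w _ <-].
have hd n w : hull v n w -> d n <= N w by move=> h; apply: ge_inf => //; exists w.
have hi n : has_inf [set N w | w in hull v n].
  by split => //; exists (N (v n)); exists (v n) => //; exact: hull_self.
have dmono m n : (m <= n)%N -> d m <= d n.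
  move=> mn; apply: lb_le_inf; first by case: (hi n).
  by move=> _ [w hw <-]; apply: hd; exact: hull_le hw.
pose ds := sup (range d).
have hs : has_sup (range d).
  split; first by exists (d 0%N); exists 0%N.
  exists (M ^+ 2) => _ [n _ <-]; apply: le_trans (NM n _ (@hull_self v n)).
  by apply: hd; exact: hull_self.
have dds n : d n <= ds by apply: ub_le_sup; [by case: hs|exists n].
(* A square, so that the L^2 distances, of order the root of [e j], are geometric. *)
pose e j : R := (2^-1 ^+ j) ^+ 2.
have e0 j : 0 < e j by rewrite !exprn_gt0.
(* The infima [d n] increase to [ds]. The tail is chosen with infimum close to [ds], then a point
   nearly minimal in it. *)
have step j : exists u : F, exists2 n, (j <= n)%N &
    [/\ hull v n u, ds - e j < d n & N u < ds + e j].
  have [_ [n0 _ <-] h0] := sup_adherent (e0 j) hs.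
  have [_ [u hu <-] h1] := inf_adherent (e0 j) (hi (maxn n0 j)).
  exists u; exists (maxn n0 j); first exact: leq_maxr.
  split => //; first by apply: lt_le_trans h0 _; apply: dmono; exact: leq_maxl.
  by apply: lt_le_trans h1 _; rewrite lerD2r; exact: dds.
have [u hu] := choice step.
have uB n : cmeas (u n) /\ aec (fun t => cabs (u n t) <= M).
  by have [k _ [h _ _]] := hu n; exact: hB h.
pose df n t := u n.+1 t - u n t.
have mdf n : cmeas (df n).
  have [[m1 _] [m2 _]] := (uB n.+1, uB n).
  rewrite /df; under eq_fun do rewrite -mulN1r.
  by apply: cmeasD => //; apply: cmeasM => //; exact: cmeas_cst.
have Bdf n : aec (fun t => cabs (df n t) <= M + M).
  have [[_ m1] [_ m2]] := (uB n.+1, uB n).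
  apply: aecS (aecI m1 m2) => t _ [h1 h2]; apply: le_trans (cabsD _ _) _.
  by rewrite cabsN lerD.
(* The midpoint of two consecutive choices lies in the larger of their hulls, so its norm is at
   least [ds - e n]. The parallelogram law leaves 2 e_(n+1) + 6 e_n. *)
have Ndf n : N (df n) <= 8 * e n.
  have [k nk [h1 h2 h3]] := hu n; have [k' nk' [h1' h2' h3']] := hu n.+1.
  have ee : e n.+1 <= e n.
    by rewrite /e [2^-1 ^+ n.+1]exprS exprMn ler_piMl ?sqr_ge0//; lra.
  pose m := fun t => (u n.+1 t + u n t) / 2%:R.
  have hm : hull v (minn k' k) m.
    apply: hull_mid; first exact: hull_le (geq_minl _ _) _ h1'.
    exact: hull_le (geq_minr _ _) _ h1.
  have dm : ds - e n <= N m.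
    apply: le_trans (hd _ _ hm); rewrite /minn; case: ifP => _; last exact: ltW.
    by apply: le_trans (ltW h2'); lra.
  have [mm mM] := hB _ _ hm.
  have [[m1 b1] [m2 b2]] := (uB n.+1, uB n).
  have -> : N (df n) = 2 * N (u n.+1) + 2 * N (u n) - 4 * N m.
    have I1 := IN _ _ m1 b1; have I2 := IN _ _ m2 b2; have I3 := IN _ _ mm mM.
    rewrite /N -!rintZ// -rintD; [|exact: RintegrableZ..].
    rewrite -rintB; [|by apply: RintegrableD; exact: RintegrableZ|exact: RintegrableZ].
    by apply: eq_rint => t _; exact: parallelogram.
  lra.
have If n : Rintegrable (fun t => cabs (df n t)).
  by apply: L1_cabs; exact: cmeas_L1 (Bdf n).
(* The computation gives q / 2 + 4 q with q = 2^-n, rounded up to 5 q. *)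
have sdf n : rint (fun t => cabs (df n t)) <= 5 * 2^-1 ^+ n.
  have I2 := IN _ _ (mdf n) (Bdf n).
  set q : R := 2^-1 ^+ n; have q0 : 0 < q by rewrite exprn_gt0.
  (* AM-GM trades the L^2 bound for an L^1 bound *)
  have h : rint (fun t => cabs (df n t)) <=
      rint (fun t => q / 2 + (2 * q)^-1 * cabs (df n t) ^+ 2).
    apply: le_rint => //.
      by apply: RintegrableD; [exact: Rintegrable_cst|exact: RintegrableZ].
    apply: aecW => t _; set x := cabs _.
    rewrite -subr_ge0 (_ : _ - _ = (2 * q)^-1 * (q - x) ^+ 2); last by field; lra.
    by rewrite mulr_ge0 ?sqr_ge0// invr_ge0; lra.
  apply: le_trans h _.
  rewrite rintD ?rint_cst ?rintZ//; [|exact: Rintegrable_cst|exact: RintegrableZ].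
  apply: (@le_trans _ _ (q / 2 + (2 * q)^-1 * (8 * q ^+ 2))).
    by rewrite lerD2l; apply: ler_wpM2l; [rewrite invr_ge0; lra|exact: Ndf].
  by rewrite (_ : (2 * q)^-1 * _ = 4 * q); [lra|field; lra].
have cv : aec (fun t => cvgn (series (fun n => cabs (df n t)))).
  by apply: (@summable_ae _ (fun n t => cabs (df n t)) 5) => // n t _; exact: cabs_ge0.
have tel (a : nat -> R) (b : nat -> R) : cvgn (series b) ->
    (forall n, `|a n.+1 - a n| <= b n) -> cvgn a.
  move=> cb ab.
  have /cvg_ex[l hl] : cvgn (series (telescope a)).
    apply: normed_cvg; apply: series_le_cvg cb => n /=.
    - exact: normr_ge0.
    - exact: le_trans (ab n).
    - exact: ab.
  apply/cvg_ex; exists (l + a 0%N).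
  have : (fun n => series (telescope a) n + a 0%N) @ \oo --> l + a 0%N.
    by apply: cvgD; [exact: hl|exact: cvg_cst].
  by under eq_fun do rewrite telescopeK subrK.
have [w [mw cw]] : exists w, cmeas w /\ aec (fun t => ccvg (u ^~ t) (w t)).
  apply: cmeas_lim; first by move=> n; have [] := uB n.
  apply: aecS cv => t _ h; split; apply: tel h _ => n;
    rewrite -ReN -ReD || rewrite -ImN -ImD; [exact: Re_cabs|exact: Im_cabs].
exists u, w; split => // n.
by have [k nk [h _ _]] := hu n; exact: hull_le h.
Qed.

End Mazur.

(** * Bounded analytic functions *)

Section Hardy.
Variable R : realType.
Local Notation F := (R -> R[i]).
Implicit Types (f g u v : F).

Lemma zetaD (j k : int) (t : R) : zeta_pow (j + k) t = zeta_pow j t * zeta_pow k t.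
Proof.
rewrite /zeta_pow intrD.
rewrite (_ : 2 * pi * _ * t = 2 * pi * j%:~R * t + 2 * pi * k%:~R * t); last by ring.
by rewrite cosD sinD; apply: complexP; rewrite /= ?ReImE //; ring.
Qed.

Lemma zeta0 (t : R) : zeta_pow 0 t = 1.
Proof. by rewrite /zeta_pow mulr0 mul0r cos0 sin0. Qed.

Lemma zeta_conj k (t : R) : conjc (zeta_pow k t) = zeta_pow (- k) t.
Proof. by rewrite /zeta_pow /= intrN mulrN mulNr cosN sinN. Qed.

Lemma cabs_zeta k (t : R) : cabs (zeta_pow k t) = 1.
Proof. by rewrite /cabs /= cos2Dsin2 sqrtr1. Qed.

Lemma zeta_at1 k : zeta_pow k (1 : R) = 1.
Proof.
have h1 : zeta_pow 1 (1 : R) = 1.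
  by rewrite /zeta_pow !mulr1 mulr_natl cos2pi sin2pi.
have hn (n : nat) : zeta_pow n (1 : R) = 1.
  elim: n => [|n ih]; first exact: zeta0.
  by rewrite (_ : n.+1%:Z = n%:Z + 1) ?zetaD ?ih ?h1 ?mulr1// -addn1 PoszD.
case: k => n //; rewrite NegzE; have := hn n.+1.
move/(congr1 (@conjc R)); rewrite zeta_conj => ->.
by rewrite conjc1.
Qed.

Lemma continuous_cosM (c : R) : continuous (fun t : R => cos (c * t)).
Proof.
move=> t; apply: (@continuous_comp _ _ _ (fun t => c * t)); last exact: continuous_cos.
by apply: cvgMr_tmp || (apply: continuousM; [exact: cst_continuous|exact: cvg_id]).
Qed.

Lemma continuous_sinM (c : R) : continuous (fun t : R => sin (c * t)).
Proof.
move=> t; apply: (@continuous_comp _ _ _ (fun t => c * t)); last exact: continuous_sin.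
by apply: cvgMr_tmp || (apply: continuousM; [exact: cst_continuous|exact: cvg_id]).
Qed.

Lemma cmeas_zeta k : cmeas (@zeta_pow R k).
Proof.
split; apply: measurable_funTS; apply: continuous_measurable_fun.
  exact: continuous_cosM.
exact: continuous_sinM.
Qed.

Lemma Linf_zeta k : Linf (@zeta_pow R k).
Proof.
by split; [exact: cmeas_zeta|exists 1; apply: aecW => t _; rewrite cabs_zeta].
Qed.

Lemma rint_derive (F0 f0 : R -> R) : continuous f0 ->
  (forall t : R, is_derive t 1 F0 (f0 t)) -> rint f0 = F0 1 - F0 0.
Proof.
move=> cf dF.
have cF : continuous F0 by move=> t; apply/differentiable_continuous/derivable1_diffP.
rewrite /rint /Rintegral (@continuous_FTC2 R f0 F0 0 1)//.
- exact: continuous_subspaceT.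
- split; first by move=> t _; have [] := dF t.
  + exact: cvg_at_right_filter (cF 0).
  + exact: cvg_at_left_filter (cF 1).
- by move=> t _; rewrite derive1E derive_val.
Qed.

Lemma rint_cosM (c : R) : c != 0 -> rint (fun t : R => cos (c * t)) = sin c / c.
Proof.
move=> c0.
have dF (t : R) : is_derive t 1 (fun t : R => c^-1 * sin (c * t)) (cos (c * t)).
  by apply: is_derive_eq; rewrite /GRing.scale /=; field.
rewrite (rint_derive (@continuous_cosM c) dF).
by rewrite mulr1 mulr0 sin0 mulr0 subr0 mulrC.
Qed.

Lemma rint_sinM (c : R) : c != 0 -> rint (fun t : R => sin (c * t)) = (1 - cos c) / c.
Proof.
move=> c0.
have dF (t : R) : is_derive t 1 (fun t : R => - c^-1 * cos (c * t)) (sin (c * t)).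
  by apply: is_derive_eq; rewrite /GRing.scale /=; field.
rewrite (rint_derive (@continuous_sinM c) dF).
by rewrite mulr1 mulr0 cos0; ring.
Qed.

Lemma cint_zeta k : cint (@zeta_pow R k) = (k == 0)%:R.
Proof.
have [->|k0] := eqVneq k 0.
  rewrite (@eq_cint _ _ (fun=> 1)); last by move=> t; rewrite zeta0.
  by apply: complexP; rewrite /= -/(rint _) rint_cst.
have c0 : 2 * pi * k%:~R != 0 :> R.
  by rewrite !mulf_neq0 ?pnatr_eq0 ?intr_eq0// gt_eqF// pi_gt0.
have [h1 h2] := zeta_at1 k; rewrite !mulr1 in h1 h2.
apply: complexP; rewrite /= -/(rint _).
  by rewrite rint_cosM// h2 mul0r.
by rewrite rint_sinM// h1 subrr mul0r.
Qed.

Lemma fourierE f k : fourier f k = cint (fun t => zeta_pow (- k) t * f t).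
Proof. by apply: eq_cint => t; rewrite zeta_conj. Qed.

Lemma fourier0 f : fourier f 0 = cint f.
Proof. by rewrite fourierE; apply: eq_cint => t; rewrite oppr0 zeta0 mul1r. Qed.

Lemma fourier_shift f j k : fourier (fun t => zeta_pow j t * f t) k = fourier f (k - j).
Proof.
rewrite !fourierE; apply: eq_cint => t.
by rewrite mulrA -zetaD; congr (zeta_pow _ _ * _); rewrite opprB addrC.
Qed.

Lemma L1_zetaM f k : Linf f -> L1 (fun t => zeta_pow k t * f t).
Proof. by move=> fL; apply: LinfM_L1; [exact: Linf_zeta|exact: Linf_L1]. Qed.

Lemma fourierD f g k : Linf f -> Linf g ->
  fourier (fun t => f t + g t) k = fourier f k + fourier g k.
Proof.
move=> fL gL; rewrite !fourierE -cintD; [|exact: L1_zetaM..].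
by apply: eq_cint => t; rewrite mulrDr.
Qed.

Lemma fourierZ (c : R[i]) f k : Linf f ->
  fourier (fun t => c * f t) k = c * fourier f k.
Proof.
move=> fL; rewrite !fourierE -cintZ; last exact: L1_zetaM.
by apply: eq_cint => t; rewrite mulrCA.
Qed.

Lemma HinfD f g : Hinf f -> Hinf g -> Hinf (fun t => f t + g t).
Proof.
move=> [fL f0] [gL g0]; split; first exact: LinfD.
by move=> k k0; rewrite fourierD// f0// g0// addr0.
Qed.

Lemma HinfZ (c : R[i]) f : Hinf f -> Hinf (fun t => c * f t).
Proof.
move=> [fL f0]; split; first by apply: LinfM => //; exact: Linf_cst.
by move=> k k0; rewrite fourierZ// f0// mulr0.
Qed.

Lemma HinfB f g : Hinf f -> Hinf g -> Hinf (fun t => f t - g t).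
Proof.
move=> hf hg; have := HinfD hf (HinfZ (-1) hg).
by under eq_fun do rewrite mulN1r.
Qed.

Lemma Hinf_cst (c : R[i]) : Hinf (fun=> c).
Proof.
split; first exact: Linf_cst.
move=> k k0; rewrite fourierE; under eq_fun do rewrite mulrC.
rewrite cintZ; last by apply: Linf_L1; exact: Linf_zeta.
by rewrite cint_zeta oppr_eq0 lt_eqF// mulr0.
Qed.

Lemma Hinf_lim (u : nat -> F) w (M : R) : (forall n, Hinf (u n)) -> cmeas w ->
  aec (fun t => forall n, cabs (u n t) <= M) ->
  aec (fun t => ccvg (u ^~ t) (w t)) -> Hinf w.
Proof.
move=> hu mw uM cu; split.
  split=> //; exists M; apply: aecS (aecI uM cu) => t _ [h1 h2].
  by apply: cvgn_le (ccvg_cabs h2) _; exact: nearW.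
move=> k k0.
have mu_ n : cmeas (u n) by have [[]] := hu n.
have cv := cint_dct mu_ mw (Linf_L1 (Linf_zeta (- k))) uM cu.
have e (h : F) : fourier h k = cint (fun t => h t * zeta_pow (- k) t).
  by rewrite fourierE; apply: eq_cint => t; rewrite mulrC.
rewrite e; apply: (ccvg_unique cv).
rewrite (_ : (fun n => _) = (fun=> 0)); first exact: ccvg_cst.
by apply/funext => n; rewrite -e; have [_] := hu n; apply.
Qed.

(* With [Hinf] defined by Fourier coefficients, it is not immediate that products of its
   members stay in it; [multiplier] collects those functions for which this, and the
   multiplicativity of the mean, can be checked by hand. *)
Definition multiplier v := Hinf v /\ forall g, Hinf g ->
  Hinf (fun t => v t * g t) /\ cint (fun t => v t * g t) = cint v * cint g.

Lemma cint_cst (c : R[i]) : cint (fun=> c) = c.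
Proof. by apply: complexP; rewrite /= -/(rint _) rint_cst. Qed.

Lemma multiplier_cst (c : R[i]) : multiplier (fun=> c).
Proof.
split; first exact: Hinf_cst.
move=> g hg; split; first exact: HinfZ.
by rewrite cint_cst cintZ//; apply: Linf_L1; case: hg.
Qed.

Lemma Hinf_L1 f : Hinf f -> L1 f. Proof. by move=> [/Linf_L1]. Qed.

Lemma multiplierD u v : multiplier u -> multiplier v -> multiplier (fun t => u t + v t).
Proof.
move=> [hu mu_] [hv mv]; split; first exact: HinfD.
move=> g hg; have [u1 u2] := mu_ _ hg; have [v1 v2] := mv _ hg.
under eq_fun do rewrite mulrDl; split; first exact: HinfD.
by rewrite !cintD ?u2 ?v2 ?mulrDl//; exact: Hinf_L1.
Qed.

Lemma multiplierM u v : multiplier u -> multiplier v -> multiplier (fun t => u t * v t).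
Proof.
move=> [hu mu_] [hv mv]; split; first by have [] := mu_ _ hv.
move=> g hg; have [v1 v2] := mv _ hg; have [u1 u2] := mu_ _ v1.
have [u3 u4] := mu_ _ hv.
under eq_fun do rewrite -mulrA; split=> //.
by rewrite u2 v2 u4 mulrA.
Qed.

Lemma cint_multiplier u v : multiplier u -> multiplier v ->
  cint (fun t => u t * v t) = cint u * cint v.
Proof. by move=> [hu mu_] [hv mv]; have [] := mu_ _ hv. Qed.

Lemma multiplierX u n : multiplier u ->
  multiplier (fun t => u t ^+ n) /\ cint (fun t => u t ^+ n) = cint u ^+ n.
Proof.
move=> mu_; elim: n => [|n [ih1 ih2]].
  by split; [exact: multiplier_cst|exact: cint_cst].
under eq_fun do rewrite exprS; split; first exact: multiplierM.
by rewrite cint_multiplier// ih2 exprS.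
Qed.

(** Multiplication by a positive power shifts the coefficients upwards; the mean of the product is
    then a coefficient of negative index, which vanishes like the mean of the power itself. *)
Lemma multiplier_zeta (n : nat) : multiplier (@zeta_pow R n).
Proof.
case: n => [|n].
  rewrite (_ : zeta_pow _ = fun=> 1); first exact: multiplier_cst.
  by apply/funext => t; rewrite zeta0.
have h g : Hinf g -> Hinf (fun t => zeta_pow n.+1 t * g t).
  move=> [gL g0]; split; first by apply: LinfM => //; exact: Linf_zeta.
  by move=> k k0; rewrite fourier_shift g0// ltrBlDr (lt_le_trans k0).
split.
  have := h _ (Hinf_cst 1); by under eq_fun do rewrite mulr1.
move=> g hg; split; first exact: h.
rewrite cint_zeta mul0r -fourier0 fourier_shift sub0r.
by case: hg => _; apply.
Qed.

Lemma multiplier_lim (u : nat -> F) w (M : R) : (forall n, multiplier (u n)) -> cmeas w ->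
  aec (fun t => forall n, cabs (u n t) <= M) ->
  aec (fun t => ccvg (u ^~ t) (w t)) -> multiplier w.
Proof.
move=> hu mw uM cu; have hw : Hinf w.
  by apply: Hinf_lim uM cu => // n; case: (hu n).
split=> // g hg.
have mg : cmeas g by case: hg => -[].
have mu_ n : cmeas (u n) by have [[[]]] := hu n.
have [_ [N gN]] := hg.1.
split.
  apply: (@Hinf_lim (fun n t => u n t * g t) _ (M * N)).
  - by move=> n; have [_ /(_ _ hg)[]] := hu n.
  - exact: cmeasM.
  - apply: aecS (aecI uM gN) => t _ [h1 h2] n; rewrite cabsM.
    by apply: ler_pM; rewrite ?cabs_ge0.
  - by apply: aecS cu => t _ h; apply: ccvgM => //; exact: ccvg_cst.
have c1 := cint_dct mu_ mw (Hinf_L1 hg) uM cu.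
(* Testing against 1 gives convergence of the means, needed for the right-hand side. *)
have c2 := cint_dct mu_ mw (Hinf_L1 (Hinf_cst 1)) uM cu.
apply: ccvg_unique c1 _.
rewrite (_ : (fun n => _) = (fun n => cint (fun t => u n t * 1) * cint g)); last first.
  apply/funext => n; have [_ /(_ _ hg)[_ ->]] := hu n.
  by congr (_ * _); apply: eq_cint => t; rewrite mulr1.
rewrite (_ : cint w = cint (fun t => w t * 1)); last by apply: eq_cint => t; rewrite mulr1.
by apply: ccvgM => //; exact: ccvg_cst.
Qed.

Lemma multiplier_mid : midconvex (@multiplier).
Proof. by move=> a b ha hb; apply: multiplierM; [exact: multiplierD|exact: multiplier_cst]. Qed.

End Hardy.

(** * Approximation by trigonometric polynomials *)

Section TrigApprox.
Variable R : realType.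
Local Notation D := (@circ R).
Local Notation Re := complex.Re.
Local Notation Im := complex.Im.
Implicit Types (p q f g : R -> R).

Inductive trigpoly : (R -> R) -> Prop :=
| trigpoly_Re (k : int) : trigpoly (fun t => Re (zeta_pow k t))
| trigpoly_Im (k : int) : trigpoly (fun t => Im (zeta_pow k t))
| trigpoly_add f g : trigpoly f -> trigpoly g -> trigpoly (fun t => f t + g t)
| trigpoly_scale (c : R) f : trigpoly f -> trigpoly (fun t => c * f t).

Lemma trigpoly_ext f g : (forall t, f t = g t) -> trigpoly f -> trigpoly g.
Proof. by move=> h; rewrite (_ : g = f)//; apply/funext => t; rewrite h. Qed.

Lemma trigpoly_cst (c : R) : trigpoly (fun=> c).
Proof.
apply: trigpoly_ext (trigpoly_scale c (trigpoly_Re 0)) => t.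
by rewrite zeta0 mulr1.
Qed.

Lemma trigpoly_mul f g : trigpoly f -> trigpoly g -> trigpoly (fun t => f t * g t).
Proof.
(* Product-to-sum formulas on generators; the two inductions extend them bilinearly. *)
have base (h : R -> R) : trigpoly h ->
    (forall k, trigpoly (fun t => Re (zeta_pow k t) * h t)) /\
    (forall k, trigpoly (fun t => Im (zeta_pow k t) * h t)).
  elim=> [j|j|h1 h2 _ [h1a h1b] _ [h2a h2b]|c h1 _ [h1a h1b]].
  - split=> k.
      apply: trigpoly_ext
        (trigpoly_scale 2^-1 (trigpoly_add (trigpoly_Re (k + j)) (trigpoly_Re (k + - j)))) => t.
      by rewrite !zetaD -zeta_conj !(ReM, ReJ, ImJ); field.
    apply: trigpoly_ext
        (trigpoly_scale 2^-1 (trigpoly_add (trigpoly_Im (k + j)) (trigpoly_Im (k + - j)))) => t.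
    by rewrite !zetaD -zeta_conj !(ImM, ReJ, ImJ); field.
  - split=> k.
      apply: trigpoly_ext
        (trigpoly_scale 2^-1 (trigpoly_add (trigpoly_Im (k + j)) (trigpoly_scale (-1) (trigpoly_Im (k + - j))))) => t.
      by rewrite !zetaD -zeta_conj !(ImM, ReJ, ImJ); field.
    apply: trigpoly_ext
        (trigpoly_scale 2^-1 (trigpoly_add (trigpoly_Re (k + - j)) (trigpoly_scale (-1) (trigpoly_Re (k + j))))) => t.
    by rewrite !zetaD -zeta_conj !(ReM, ReJ, ImJ); field.
  - by split=> k; [apply: trigpoly_ext (trigpoly_add (h1a k) (h2a k))|
      apply: trigpoly_ext (trigpoly_add (h1b k) (h2b k))]
      => t; ring.
  - by split=> k; [apply: trigpoly_ext (trigpoly_scale c (h1a k))|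
      apply: trigpoly_ext (trigpoly_scale c (h1b k))]
      => t; ring.
move=> tf tg; have [ga gb] := base _ tg.
elim: tf => [k|k|h1 h2 _ i1 _ i2|c h1 _ i1]; [exact: ga|exact: gb| |].
- by apply: trigpoly_ext (trigpoly_add i1 i2) => t; ring.
- by apply: trigpoly_ext (trigpoly_scale c i1) => t; ring.
Qed.

Lemma trigpoly_exp f n : trigpoly f -> trigpoly (fun t => f t ^+ n).
Proof.
move=> tf; elim: n => [|n ih]; first exact: trigpoly_cst.
by apply: trigpoly_ext (trigpoly_mul tf ih) => t; rewrite exprS.
Qed.

Lemma trigpoly_onem f : trigpoly f -> trigpoly (fun t => 1 - f t).
Proof.
move=> tf; apply: trigpoly_ext (trigpoly_add (trigpoly_cst 1) (trigpoly_scale (-1) tf)) => t.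
by rewrite mulN1r.
Qed.

Lemma trigpoly_mfun f : trigpoly f -> mfun f.
Proof.
elim=> [k|k|h1 h2 _ i1 _ i2|c h1 _ i1].
- by have [] := @cmeas_zeta R k.
- by have [] := @cmeas_zeta R k.
- exact: measurable_funD.
- by apply: measurable_funM => //; exact: measurable_cst.
Qed.

(** For polynomials the harmonic conjugate is explicit: cosines are real parts of nonnegative powers
    of zeta, sines those of the same powers times i or -i. The real mean makes the mean of [P] equal
    to that of [q]. *)
Lemma trigpoly_lift q : trigpoly q -> exists P : R -> R[i],
  [/\ multiplier P, (forall t, Re (P t) = q t), Im (cint P) = 0 &
      exists M : R, forall t, cabs (P t) <= M].
Proof.
have Imi : Im (Complex 0 (-1) : R[i]) = -1 by [].
have bz (c : R[i]) k : exists M : R, forall t : R, cabs (c * zeta_pow k t) <= M.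
  by exists (cabs c) => t; rewrite cabsM cabs_zeta mulr1.
have ci (c : R[i]) (n : nat) : cint (fun t : R => c * zeta_pow n t) = c * (n == 0)%:R.
  by rewrite cintZ ?cint_zeta//; apply: Linf_L1; exact: Linf_zeta.
have mz (c : R[i]) (n : nat) : multiplier (fun t : R => c * zeta_pow n t).
  by apply: multiplierM; [exact: multiplier_cst|exact: multiplier_zeta].
elim=> [k|k|h1 h2 _ [P1 [a1 b1 c1 [M1 d1]]] _ [P2 [a2 b2 c2 [M2 d2]]]|c h1 _ [P1 [a1 b1 c1 [M1 d1]]]].
- case: k => n; last first.
    exists (fun t => 1 * zeta_pow n.+1 t); split=> //.
    + by move=> t; rewrite NegzE -zeta_conj ReJ mul1r.
    + by rewrite ci mulr0.
  exists (fun t => 1 * zeta_pow n t); split=> //.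
  + by move=> t; rewrite mul1r.
  + by rewrite ci mul1r; case: (n == 0).
- case: k => n; last first.
    exists (fun t => Complex 0 1 * zeta_pow n.+1 t); split=> //.
    + by move=> t; rewrite NegzE -zeta_conj ImJ ReM /= mul0r mul1r sub0r.
    + by rewrite ci mulr0.
  (* Frequency 0 is set apart: -i times the constant 1 would have a non-real mean. *)
  case: n => [|n].
    exists (fun t => 0); split=> //; first exact: multiplier_cst.
    + by move=> t; rewrite zeta0.
    + by rewrite cint_cst.
    + by exists 0 => t; rewrite cabs0.
  exists (fun t => Complex 0 (-1) * zeta_pow n.+1 t); split=> //.
  + by move=> t; rewrite ReM /= mul0r mulN1r sub0r opprK.
  + by rewrite ci mulr0.
- exists (fun t => P1 t + P2 t); split.
  + exact: multiplierD.
  + by move=> t; rewrite ReD b1 b2.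
  + by rewrite cintD ?ImD ?c1 ?c2 ?addr0//; apply: Hinf_L1; [case: a1|case: a2].
  + by exists (M1 + M2) => t; apply: le_trans (cabsD _ _) _; rewrite lerD.
- exists (fun t => Complex c 0 * P1 t); split.
  + by apply: multiplierM => //; exact: multiplier_cst.
  + by move=> t; rewrite ReM b1 /= mul0r subr0.
  + by rewrite cintZ ?ImM ?c1 /= ?mulr0 ?mul0r ?addr0//; apply: Hinf_L1; case: a1.
  + by exists (cabs (Complex c 0) * M1) => t; rewrite cabsM ler_wpM2l ?cabs_ge0.
Qed.

(** Keeping the approximants in [0, 1] is what makes L^1 approximation compatible with products,
    hence with intersections of sets. *)
Definition approx q := forall e : R, 0 < e -> exists p,
  [/\ trigpoly p, (forall t, 0 <= p t <= 1) & rint (fun t => `|p t - q t|) <= e].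

Definition unit_fun q := mfun q /\ forall t, D t -> 0 <= q t <= 1.

Lemma Rintegrable_unit q : unit_fun q -> Rintegrable q.
Proof.
move=> [mq q1]; apply: (Rintegrable_bdd (M := 1)) => //; apply: aecW => t Dt.
by have /andP[h1 h2] := q1 t Dt; rewrite ger0_norm.
Qed.

Lemma trigpoly_unit p : trigpoly p -> (forall t, 0 <= p t <= 1) -> unit_fun p.
Proof. by move=> tp p1; split => //; exact: trigpoly_mfun. Qed.

Lemma Rintegrable_dist p q : unit_fun p -> unit_fun q -> Rintegrable (fun t => `|p t - q t|).
Proof. by move=> hp hq; apply: Rintegrable_abs; apply: RintegrableB; exact: Rintegrable_unit. Qed.

Lemma approx_trigpoly p : trigpoly p -> (forall t, 0 <= p t <= 1) -> approx p.
Proof.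
move=> tp p1 e e0; exists p; split=> //.
rewrite (@eq_rint _ _ (fun=> 0)) ?rint_cst ?ltW// => t _.
by rewrite subrr normr0.
Qed.

Lemma approx_lim (q_ : nat -> R -> R) q : (forall n, unit_fun (q_ n)) -> unit_fun q ->
  (forall n, approx (q_ n)) -> aec (fun t => q_ ^~ t @ \oo --> q t) -> approx q.
Proof.
move=> uq_ uq aq cq e e0.
have : rint (fun t => `|q_ n t - q t|) @[n --> \oo] --> rint (fun t : R => 0 : R).
  apply: (@rint_dct _ _ _ (fun=> 1)).
  - by move=> n; apply: Rintegrable_mfun; exact: Rintegrable_dist.
  - exact: measurable_cst.
  - exact: Rintegrable_cst.
  - apply: aecS cq => t _ h; rewrite -(normr0 R) -(subrr (q t)).
    by apply: cvg_norm; apply: cvgB => //; exact: cvg_cst.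
  - apply: aecW => t Dt n; rewrite normr_id.
    have /andP[h1 h2] := (uq_ n).2 t Dt; have /andP[h3 h4] := uq.2 t Dt.
    by rewrite ler_norml; lra.
rewrite rint_cst => h.
have e2 : 0 < e / 2 by lra.
have [N hN] := cvgn0_lt h e2.
have [p [tp p1 hp]] := aq N _ e2; exists p; split=> //.
have up := trigpoly_unit tp p1.
apply: (@le_trans _ _ (rint (fun t => `|p t - q_ N t| + `|q_ N t - q t|))).
  apply: le_rint; [exact: Rintegrable_dist|by apply: RintegrableD; exact: Rintegrable_dist|].
  by apply: aecW => t _; rewrite -(subrKA (q_ N t)) ler_normD.
rewrite rintD; [|exact: Rintegrable_dist..].
have := hN N (leqnn N); have := ler_norm (rint (fun t => `|q_ N t - q t|)); lra.
Qed.

(** These sets are shown to form a sigma-algebra containing the rays, hence to be all measurable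
    sets. *)
Definition approx_set (A : set R) := measurable A /\ approx \1_A.

Lemma unit_indic (A : set R) : measurable A -> unit_fun \1_A.
Proof.
move=> mA; split; first exact: measurable_indic.
by move=> t _; rewrite indicE ler0n /= lern1 leq_b1.
Qed.

Lemma approx_set_ae (A : set R) q : measurable A -> unit_fun q -> approx q ->
  aec (fun t => q t = \1_A t) -> approx_set A.
Proof.
move=> mA uq aq h; split=> //.
apply: (@approx_lim (fun=> q)) => //; first exact: unit_indic.
by apply: aecS h => t _ ->; exact: cvg_cst.
Qed.

Lemma approx_setC (A : set R) : approx_set A -> approx_set (~` A).
Proof.
move=> [mA aA]; split; first exact: measurableC.
move=> e e0; have [p [tp p1 hp]] := aA e e0; exists (fun t => 1 - p t); split.
- exact: trigpoly_onem.
- by move=> t; have /andP[] := p1 t; lra.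
- rewrite (@eq_rint _ _ (fun t => `|p t - \1_A t|))// => t _.
  rewrite !indicE in_setC; case: (t \in A) => /=; rewrite -[RHS]normrN; congr `|_|; ring.
Qed.

Lemma approx_setI (A B : set R) : approx_set A -> approx_set B -> approx_set (A `&` B).
Proof.
move=> [mA aA] [mB aB]; split; first exact: measurableI.
move=> e e0; have e2 : 0 < e / 2 by lra.
have [p [tp p1 hp]] := aA _ e2; have [q [tq q1 hq]] := aB _ e2.
exists (fun t => p t * q t); split.
- exact: trigpoly_mul.
- by move=> t; have /andP[? ?] := p1 t; have /andP[? ?] := q1 t; rewrite mulr_ge0//= mulr_ile1.
have uA := unit_indic mA; have uB := unit_indic mB.
have up := trigpoly_unit tp p1; have uq := trigpoly_unit tq q1.
apply: (@le_trans _ _ (rint (fun t => `|p t - \1_A t| + `|q t - \1_B t|))).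
  apply: le_rint; last first.
  - apply: aecW => t Dt; rewrite indicI /=.
    have /andP[a1 a2] := p1 t; have /andP[b1 b2] := uB.2 t Dt.
    (* Both coefficients lie in [0, 1], so the two errors simply add up. *)
    rewrite (_ : _ - _ = p t * (q t - \1_B t) + \1_B t * (p t - \1_A t)); last by rewrite /=; ring.
    apply: le_trans (ler_normD _ _) _; rewrite addrC !normrM (ger0_norm a1) (ger0_norm b1).
    by apply: lerD; rewrite ler_piMl.
  - by apply: RintegrableD; exact: Rintegrable_dist.
  - apply: Rintegrable_dist; last by apply: unit_indic; exact: measurableI.
    apply: trigpoly_unit; first exact: trigpoly_mul.
    by move=> t; have /andP[? ?] := p1 t; have /andP[? ?] := q1 t; rewrite mulr_ge0//= mulr_ile1.
by rewrite rintD; [lra|exact: Rintegrable_dist..].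
Qed.

Lemma approx_set0 : approx_set set0.
Proof.
apply: (@approx_set_ae _ (fun=> 0)) => //.
- by split=> [|t _]; [exact: measurable_cst|rewrite lexx ler01].
- by apply: approx_trigpoly => [|t]; [exact: trigpoly_cst|rewrite lexx ler01].
- by apply: aecW => t _; rewrite indic0.
Qed.

(** Finite unions come from complements and intersections; their indicators converge pointwise to
    that of the whole union. *)
Lemma approx_set_bigcup (A : nat -> set R) : (forall n, approx_set (A n)) ->
  approx_set (\bigcup_n A n).
Proof.
move=> gA.
pose B n := \big[setU/set0]_(i < n) A i.
have gB n : approx_set (B n).
  rewrite /B; elim: n => [|n ih]; first by rewrite big_ord0; exact: approx_set0.
  rewrite big_ord_recr /= -[X in approx_set X]setCK setCU.
  by apply: approx_setC; apply: approx_setI; exact: approx_setC.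
split; first by apply: bigcupT_measurable => n; case: (gA n).
apply: (@approx_lim (fun n => \1_(B n))).
- by move=> n; apply: unit_indic; case: (gB n).
- by apply: unit_indic; apply: bigcupT_measurable => n; case: (gA n).
- by move=> n; case: (gB n).
- apply: aecW => t _; have [[n _ At]|h] := pselect ((\bigcup_n A n) t).
    apply: cvg_near_cst; exists n.+1 => //= m nm.
    rewrite !indicE !mem_set//; first by exists n.
    rewrite /B -bigcup_mkord; exists n => //.
  apply: cvg_near_cst; apply: nearW => m; rewrite !indicE !memNset//.
  by rewrite /B -bigcup_mkord => -[k _ Ak]; apply: h; exists k.
Qed.

End TrigApprox.

(** * L^1 density of trigonometric polynomials, with control of the sup norm *)

Section TrigDensity.
Variable R : realType.
Local Notation D := (@circ R).
Local Notation Re := complex.Re.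
Local Notation Im := complex.Im.
Implicit Types (p q f g : R -> R).

Lemma bernoulli_ge (x : R) n : 0 <= x <= 1 -> 1 - n%:R * x <= (1 - x) ^+ n.
Proof.
move=> /andP[x0 x1]; elim: n => [|n ih]; first by rewrite mul0r subr0 expr0.
rewrite exprS; apply: (@le_trans _ _ ((1 - x) * (1 - n%:R * x))).
  rewrite -subr_ge0 -natr1.
  rewrite (_ : _ - _ = n%:R * x ^+ 2); last by ring.
  by rewrite mulr_ge0 ?sqr_ge0.
by apply: ler_wpM2l => //; lra.
Qed.

Lemma bernoulli_le (x : R) n : 0 <= x <= 1 -> (1 + n%:R * x) * (1 - x) ^+ n <= 1.
Proof.
move=> /andP[x0 x1]; elim: n => [|n ih]; first by rewrite mul0r addr0 expr0 mulr1.
apply: le_trans ih; rewrite exprS mulrA; apply: ler_wpM2r; first by rewrite exprn_ge0//; lra.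
rewrite -subr_ge0 -natr1.
rewrite (_ : _ - _ = (n%:R + 1) * x ^+ 2); last by ring.
by rewrite mulr_ge0 ?sqr_ge0// addr_ge0.
Qed.

(* The polynomials of the classical Stone-Weierstrass argument: by Bernoulli's inequality they
   separate [x < 1/2] from [x > 1/2]. *)
Definition stepX (n : nat) (x : R) : R := (1 - x ^+ n) ^+ (2 ^ n).

Lemma exp_unit (x : R) n : 0 <= x <= 1 -> 0 <= x ^+ n <= 1.
Proof. by move=> /andP[x0 x1]; rewrite exprn_ge0//= exprn_ile1. Qed.

Lemma stepX_unit n (x : R) : 0 <= x <= 1 -> 0 <= stepX n x <= 1.
Proof. by move=> /(exp_unit n)/andP[h1 h2]; apply: exp_unit; lra. Qed.

Lemma stepX_lt (x : R) : 0 <= x -> x < 2^-1 -> stepX n x @[n --> \oo] --> (1 : R).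
Proof.
move=> x0 x2; have x1 : 0 <= x <= 1 by lra.
apply: (@squeeze_cvgr _ _ _ _ (fun n => 1 - geometric 1 (2 * x) n) (fun=> 1)).
- apply: nearW => n; have /andP[_ ->] := stepX_unit n x1; rewrite andbT /=.
  rewrite mul1r exprMn -natrX; exact: bernoulli_ge (exp_unit n x1).
- rewrite -[X in _ --> X]subr0; apply: cvgB; first exact: cvg_cst.
  by apply: cvg_geometric; rewrite ger0_norm; lra.
- exact: cvg_cst.
Qed.

Lemma stepX_gt (x : R) : x <= 1 -> 2^-1 < x -> stepX n x @[n --> \oo] --> (0 : R).
Proof.
move=> x0 x2; have x1 : 0 <= x <= 1 by lra.
apply: (@squeeze_cvgr _ _ _ _ (fun=> 0) (geometric 1 (2 * x)^-1)).
- apply: nearW => n; have /andP[s0 _] := stepX_unit n x1; rewrite s0 /= mul1r exprVn.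
  have y0 : 0 < (2 * x) ^+ n by rewrite exprn_gt0//; lra.
  rewrite -[leRHS]mul1r ler_pdivlMr// mulrC.
  apply: le_trans (bernoulli_le (2 ^ n) (exp_unit n x1)).
  by apply: ler_wpM2r => //; rewrite exprMn -natrX; lra.
- exact: cvg_cst.
- by apply: cvg_geometric; rewrite ger0_norm ?invr_ge0 ?invf_lt1; lra.
Qed.

(** A trigonometric polynomial [F] of degree 1 is positive on the arc from [a] to 1 and negative on
    the rest: the cosine centred at the middle of the arc, minus its value at the endpoints. [FE2]
    displays the signs. *)
Lemma approx_set_arc (a : R) : 0 <= a < 1 -> approx_set (`]a, +oo[ : set R).
Proof.
move=> a01.
pose F (t : R) : R := cos (pi * (1 + a)) * Re (zeta_pow 1 t) +
  (sin (pi * (1 + a)) * Im (zeta_pow 1 t) + - cos (pi * (1 - a))).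
have FE t : F t = cos (2 * pi * t - pi * (1 + a)) - cos (pi * (1 - a)).
  rewrite /F /= mulr1 cosB; ring.
have tF : trigpoly F.
  apply: trigpoly_add; first exact/trigpoly_scale/trigpoly_Re.
  by apply: trigpoly_add; [exact/trigpoly_scale/trigpoly_Im|exact: trigpoly_cst].
have FE2 t : F t = 2 * sin (pi * (t - a)) * sin (pi * (1 - t)).
  rewrite FE.
  have -> : 2 * pi * t - pi * (1 + a) = pi * (t - a) - pi * (1 - t) by ring.
  have -> : pi * (1 - a) = pi * (t - a) + pi * (1 - t) by ring.
  by rewrite cosB cosD; ring.
have F2 t : `|F t| <= 2.
  rewrite FE; apply: le_trans (ler_normB _ _) _.
  have h (x : R) : `|cos x| <= 1 by rewrite ler_norml cos_geN1 cos_le1.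
  by have := h (2 * pi * t - pi * (1 + a)); have := h (pi * (1 - a)); lra.
(* As |F| <= 2, this maps into [0, 1], and F > 0 corresponds to x < 1/2, where [stepX] tends to
   1. *)
pose x t := 2^-1 + - 4^-1 * F t.
have x01 t : 0 <= x t <= 1.
  by have := F2 t; rewrite ler_norml /x => /andP[? ?]; lra.
have tx : trigpoly x by apply: trigpoly_add; [exact: trigpoly_cst|exact: trigpoly_scale].
have ts n : trigpoly (fun t => stepX n (x t)).
  by apply: trigpoly_exp; apply: trigpoly_onem; exact: trigpoly_exp.
have mA : measurable (`]a, +oo[ : set R) by exact: measurable_itv.
split=> //; apply: (@approx_lim _ (fun n t => stepX n (x t))).
- by move=> n; apply: trigpoly_unit => // t; exact: stepX_unit.
- exact: unit_indic.
- by move=> n; apply: approx_trigpoly => // t; exact: stepX_unit.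
(* At 0, 1 and [a] the polynomial [F] vanishes and [stepX] decides nothing; these points are
   discarded. *)
have ne (b : R) : aec (fun t => t != b).
  exists [set b]; split; [exact: measurable_set1|exact: lebesgue_measure_set1|].
  by move=> t /=; apply: contra_notP => /eqP.
apply: aecS (aecI (ne 0) (aecI (ne 1) (ne a))) => t Dt [t0 [t1 ta]].
have /andP[t0' t1'] : 0 < t < 1.
  by move: Dt; rewrite /circ /= in_itv /= !lt_neqAle t1 eq_sym t0.
have pi0 := pi_gt0 R.
have s1 : 0 < sin (pi * (1 - t)).
  apply: sin_gt0_pi; rewrite mulr_gt0//=; last by lra.
  by rewrite gtr_pMr//; lra.
case: (ltgtP t a) ta => // ta _.
- rewrite indicE memNset; last by rewrite /= in_itv /= andbT => h; lra.
  apply: stepX_gt; first by have /andP[] := x01 t.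
  suff : F t < 0 by rewrite /x; lra.
  rewrite FE2 -(opprB a) mulrN sinN mulrN mulNr oppr_lt0 !mulr_gt0//.
  apply: sin_gt0_pi; rewrite mulr_gt0//=; last by lra.
  by rewrite gtr_pMr//; lra.
- rewrite indicE mem_set; last by rewrite /= in_itv /= andbT.
  apply: stepX_lt; first by have /andP[] := x01 t.
  suff : 0 < F t by rewrite /x; lra.
  rewrite FE2 !mulr_gt0//.
  apply: sin_gt0_pi; rewrite mulr_gt0//=; last by lra.
  by rewrite gtr_pMr//; lra.
Qed.

(** Apart from the arcs, a ray contains the whole circle or misses it. *)
Lemma approx_set_ray (a : R) : approx_set (`]a, +oo[ : set R).
Proof.
have mA : measurable (`]a, +oo[ : set R) by exact: measurable_itv.
have [a0|a0] := ltP a 0.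
  apply: (@approx_set_ae _ _ (fun=> 1)) => //.
  - by split=> [|t _]; [exact: measurable_cst|rewrite lexx ler01].
  - by apply: approx_trigpoly => [|t]; [exact: trigpoly_cst|rewrite lexx ler01].
  - apply: aecW => t; rewrite /circ /= in_itv /= => /andP[t0 _].
    by rewrite indicE mem_set//= in_itv /= andbT; lra.
have [a1|a1] := ltP a 1; first by apply: approx_set_arc; rewrite a0.
apply: (@approx_set_ae _ _ (fun=> 0)) => //.
- by split=> [|t _]; [exact: measurable_cst|rewrite lexx ler01].
- by apply: approx_trigpoly => [|t]; [exact: trigpoly_cst|rewrite lexx ler01].
- apply: aecW => t; rewrite /circ /= in_itv /= => /andP[_ t1].
  by rewrite indicE memNset//= in_itv /= andbT; lra.
Qed.

Lemma approx_set_measurable (A : set R) : measurable A -> approx_set A.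
Proof.
move=> mA.
have : (@ocitv R).-sigma.-measurable A by exact: mA.
rewrite RGenOInfty.measurableE; apply: smallest_sub; last first.
  by move=> _ [a ->]; exact: approx_set_ray.
split; first exact: approx_set0.
  by move=> B gB; rewrite setTD; exact: approx_setC.
exact: approx_set_bigcup.
Qed.

(* Binary expansion: q = (b + q') / 2 with b the indicator of q >= 1/2. *)
Lemma approx_unit_bin n q e : unit_fun q -> 0 < e -> exists p,
  [/\ trigpoly p, (forall t, 0 <= p t <= 1) & rint (fun t => `|p t - q t|) <= 2^-1 ^+ n + e].
Proof.
move=> + e0; elim: n q => [|n ih] q uq.
  exists (fun=> 0); split; [exact: trigpoly_cst|by move=> _; rewrite lexx ler01|].
  rewrite expr0; apply: (@le_trans _ _ (rint (fun t : R => 1))); last by rewrite rint_cst; lra.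
  apply: le_rint; [|exact: Rintegrable_cst|].
    apply: Rintegrable_dist => //; split; first exact: measurable_cst.
    by move=> t _; rewrite lexx ler01.
  apply: aecW => t Dt; rewrite sub0r normrN.
  by have /andP[q0 q1] := uq.2 t Dt; rewrite ger0_norm.
have [mq q01] := uq.
pose A : set R := D `&` [set t | 2^-1 <= q t].
have mA : measurable A.
  by apply: (@measurable_fun_le _ _ R D (fun=> 2^-1) q) => //; exact: measurable_circ.
have uA := unit_indic mA.
pose q' t := 2 * q t - \1_A t.
have uq' : unit_fun q'.
  split; first by apply: measurable_funB; [exact: measurable_funM|case: uA].
  move=> t Dt; have := q01 t Dt; rewrite /q' indicE.
  have [h|h] := leP 2^-1 (q t).
    have -> : (t \in A) = true by rewrite mem_set.
    by rewrite /= mulr1n; lra.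
  have -> : (t \in A) = false by apply: memNset => -[_ /=]; lra.
  by rewrite /= mulr0n; lra.
have [p1 [tp1 p11 h1]] := (approx_set_measurable mA).2 e e0.
have [p2 [tp2 p21 h2]] := ih q' uq'.
have tp : trigpoly (fun t => 2^-1 * (p1 t + p2 t)) by apply: trigpoly_scale; exact: trigpoly_add.
have pu t : 0 <= 2^-1 * (p1 t + p2 t) <= 1.
  by have := p11 t; have := p21 t; lra.
exists (fun t => 2^-1 * (p1 t + p2 t)); split=> //.
have up1 := trigpoly_unit tp1 p11; have up2 := trigpoly_unit tp2 p21.
have up := trigpoly_unit tp pu.
apply: (@le_trans _ _ (rint (fun t => 2^-1 * (`|p1 t - \1_A t| + `|p2 t - q' t|)))).
  apply: le_rint; [exact: Rintegrable_dist| |].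
    by apply: RintegrableZ; apply: RintegrableD; exact: Rintegrable_dist.
  apply: aecW => t _.
  rewrite (_ : _ - _ = 2^-1 * ((p1 t - \1_A t) + (p2 t - q' t))); last by rewrite /q'; field.
  rewrite normrM ger0_norm ?invr_ge0//; apply: ler_wpM2l; first by rewrite invr_ge0.
  exact: ler_normD.
rewrite rintZ; last by apply: RintegrableD; exact: Rintegrable_dist.
rewrite rintD; [|exact: Rintegrable_dist..].
rewrite exprS; lra.
Qed.

Lemma approx_unit q : unit_fun q -> approx q.
Proof.
move=> uq e e0; have e2 : 0 < e / 2 by lra.
have [N hN] := cvgn0_lt (@cvg_half_exp R) e2.
have [p [tp p1 hp]] := approx_unit_bin N uq e2; exists p; split=> //.
by have := hN N (leqnn N); have := ler_norm (2^-1 ^+ N : R); lra.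
Qed.

Lemma trig_dense q (M e : R) : mfun q -> aec (fun t => `|q t| <= M) -> 0 < M -> 0 < e ->
  exists p, [/\ trigpoly p, (forall t, `|p t| <= M) & rint (fun t => `|p t - q t|) <= e].
Proof.
move=> mq qM M0 e0.
(* The affine image of [q] in [0, 1], clipped because the bound on [q] holds only almost
   everywhere. *)
pose r t := Num.min 1 (Num.max 0 ((2 * M)^-1 * (q t + M))).
have ur : unit_fun r.
  split; last by move=> t _; rewrite /r le_min le_max lexx ler01 ge_min lexx.
  apply: measurable_minr; first exact: measurable_cst.
  apply: measurable_maxr; first exact: measurable_cst.
  by apply: measurable_funM => //; apply: measurable_funD.
have e2 : 0 < e / (2 * M) by rewrite divr_gt0//; lra.
have [p [tp p1 hp]] := approx_unit ur e2.
exists (fun t => 2 * M * p t + - M); split.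
- by apply: trigpoly_add; [exact: trigpoly_scale|exact: trigpoly_cst].
- move=> t; have /andP[a b] := p1 t; rewrite ler_norml.
  by apply/andP; split; nra.
have Iq : Rintegrable q by exact: Rintegrable_bdd qM.
have up := trigpoly_unit tp p1.
have -> : rint (fun t => `|2 * M * p t + - M - q t|) = rint (fun t => 2 * M * `|p t - r t|).
  apply: eq_rint_ae.
  - apply: Rintegrable_mfun; apply: Rintegrable_abs; apply: RintegrableB => //.
    by apply: RintegrableD; [apply: RintegrableZ; exact: Rintegrable_unit|exact: Rintegrable_cst].
  - by apply: Rintegrable_mfun; apply: RintegrableZ; exact: Rintegrable_dist.
  apply: aecS qM => t _; rewrite ler_norml => /andP[a b].
  have -> : r t = (2 * M)^-1 * (q t + M).
    rewrite /r max_r ?min_r//.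
      by rewrite ler_pdivrMl ?mulr1; lra.
    by rewrite mulr_ge0 ?invr_ge0; lra.
  have -> : 2 * M * `|p t - (2 * M)^-1 * (q t + M)| = `|2 * M * (p t - (2 * M)^-1 * (q t + M))|.
    by rewrite [RHS]normrM (ger0_norm (_ : 0 <= 2 * M))//; lra.
  by congr `|_|; field; lra.
rewrite rintZ; last exact: Rintegrable_dist.
by rewrite mulrC -ler_pdivlMr//; lra.
Qed.

End TrigDensity.

(** * Outer functions *)

Section Outer.
Variable R : realType.
Local Notation Re := complex.Re.
Local Notation Im := complex.Im.
Local Notation F := (R -> R[i]).

(** At a fixed point the disc of radius [B0 t + e] is convex and contains the whole tail of [v],
    hence the values of the combinations [u n], hence their limit. *)
Lemma hull_aec_le (v u : nat -> F) (B : nat -> R -> R) (B0 : R -> R) (w : F) :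
  (forall n, hull v n (u n)) -> (forall n, aec (fun t => cabs (v n t) <= B n t)) ->
  aec (fun t => B ^~ t @ \oo --> B0 t) -> aec (fun t => ccvg (u ^~ t) (w t)) ->
  aec (fun t => cabs (w t) <= B0 t).
Proof.
move=> hu vB cB cu.
apply: aecS (aecI (aec_forall vB) (aecI cB cu)) => t _ [h1 [h2 h3]].
apply/ler_addgt0Pr => e e0.
move/cvgrPdist_lt: h2 => /(_ _ e0)[N _ hN].
apply: cvgn_le (ccvg_cabs h3) _; exists N => // n Nn /=.
apply: (hu n (fun f => cabs (f t) <= B0 t + e)); first by move=> a b; exact: cabs_mid.
move=> m nm; apply: le_trans (h1 m) _.
have := hN m (leq_trans Nn nm); rewrite distrC => /ltr_normlW; lra.
Qed.

(** The substitute for normal families: moduli bounded above and means bounded below pass to some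
    limit. The combinations [u] are kept in the conclusion because [E_full] must follow them inside
    [E]. *)
Lemma multiplier_mazur (v : nat -> F) (B : nat -> R -> R) (B0 : R -> R)
    (b : nat -> R) (b0 M : R) :
  (forall n, multiplier (v n)) -> (forall n, aec (fun t => cabs (v n t) <= B n t)) ->
  (forall n, aec (fun t => B n t <= M)) -> aec (fun t => B ^~ t @ \oo --> B0 t) ->
  (forall n, b n <= Re (cint (v n))) -> b @ \oo --> b0 ->
  exists (u : nat -> F) (w : F),
  [/\ forall n, hull v n (u n), aec (fun t => ccvg (u ^~ t) (w t)),
      multiplier w, aec (fun t => cabs (w t) <= B0 t) & b0 <= Re (cint w)].
Proof.
move=> mv vB BM cB vb cb.
have vM n : aec (fun t => cabs (v n t) <= M).
  by apply: aecS (aecI (vB n) (BM n)) => t _ [h1 h2]; exact: le_trans h2.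
have mmv n : cmeas (v n) by have [[[]]] := mv n.
have [u [w [hu mw cu]]] := mazur mmv vM.
have uM n : cmeas (u n) /\ aec (fun t => cabs (u n t) <= M).
  by apply: (hu n _ (@midconvex_bdd R M)) => m _.
have mu_ n : multiplier (u n) by apply: (hu n _ (@multiplier_mid R)) => m _.
have uMa : aec (fun t => forall n, cabs (u n t) <= M).
  by apply: aec_forall => n; case: (uM n).
have uc n : cmeas (u n) by case: (uM n).
have mw' := multiplier_lim mu_ mw uMa cu.
exists u, w; split => //; first exact: hull_aec_le vB cB cu.
apply/ler_addgt0Pr => e e0; rewrite -lerBlDr.
move/cvgrPdist_lt: cb => /(_ _ e0)[N _ hN].
have [c1 _] := cint_dct uc mw (Hinf_L1 (Hinf_cst 1)) uMa cu.
have m1 (f : F) : cint (fun t => f t * 1) = cint f by apply: eq_cint => t; rewrite mulr1.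
have {}c1 : Re (cint (u n)) @[n --> \oo] --> Re (cint w).
  by move: c1; rewrite m1; under eq_fun do rewrite m1.
apply: cvgn_ge c1 _; exists N => // n Nn /=.
(* The half-plane condition is carried jointly with [multiplier], which supplies the integrability
   that makes the mean of a midpoint the midpoint of the means. *)
have [_ h] : multiplier (u n) /\ b0 - e <= Re (cint (u n)); last exact: h.
apply: (hu n (fun f => multiplier f /\ b0 - e <= Re (cint f))).
  move=> a c [ma a1] [mc c1']; split; first exact: multiplier_mid.
  rewrite cint_multiplier ?cint_cst; [|exact: multiplierD|exact: multiplier_cst].
  rewrite half_complex cintD; [|by apply: Hinf_L1; case: ma|by apply: Hinf_L1; case: mc].
  by rewrite ReX ReD; lra.
move=> m nm; split=> //; apply: le_trans (vb m).
have := hN m (leq_trans Nn nm) => /ltr_normlW; lra.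
Qed.

Corollary multiplier_limit (v : nat -> F) (B : nat -> R -> R) (B0 : R -> R)
    (b : nat -> R) (b0 M : R) :
  (forall n, multiplier (v n)) -> (forall n, aec (fun t => cabs (v n t) <= B n t)) ->
  (forall n, aec (fun t => B n t <= M)) -> aec (fun t => B ^~ t @ \oo --> B0 t) ->
  (forall n, b n <= Re (cint (v n))) -> b @ \oo --> b0 ->
  exists w : F, [/\ multiplier w, aec (fun t => cabs (w t) <= B0 t) & b0 <= Re (cint w)].
Proof.
move=> h1 h2 h3 h4 h5 h6.
by have [u [w [_ _ h h' h'']]] := multiplier_mazur h1 h2 h3 h4 h5 h6; exists w.
Qed.

(** The inequality 1 + x <= exp x at x = - y / (1 + y), inverted. It bounds (1 + c / k) ^ k from
    below. *)
Lemma expR_frac_le (y : R) : -1 < y -> expR (y / (1 + y)) <= 1 + y.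
Proof.
move=> y1; have y0 : 0 < 1 + y by lra.
have := expR_ge1Dx (- (y / (1 + y))).
rewrite expRN (_ : 1 - y / (1 + y) = (1 + y)^-1); last by field; lra.
by rewrite lef_pV2 ?posrE ?expR_gt0.
Qed.

(* v = (1 + P / k) ^ k with Re P = p and k large *)
Lemma exp_trigpoly (p : R -> R) (e : R) : trigpoly p -> 0 < e -> exists v : F,
  [/\ multiplier v, (forall t, cabs (v t) <= expR (p t + e)) & expR (rint p - e) <= Re (cint v)].
Proof.
move=> /trigpoly_lift[P [mP PE P0 [M PM]]] e0.
set c := rint p.
have cP : cint P = Complex c 0.
  by apply: complexP => //=; apply: eq_rint => t _; exact: PE.
have M0 : 0 <= M by apply: le_trans (PM 0); exact: cabs_ge0.
(* Large enough that M^2 + 2 c^2 <= e k, which controls both second-order errors, and that |c / k|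
   <= 1/2. *)
pose k := (Num.trunc ((M ^+ 2 + 2 * c ^+ 2) / e + 2 * `|c| + 1)).+1.
have kk : (M ^+ 2 + 2 * c ^+ 2) / e + 2 * `|c| + 1 < k%:R.
  exact: truncnS_gt.
have q0 : 0 <= (M ^+ 2 + 2 * c ^+ 2) / e.
  by apply: divr_ge0; [have := sqr_ge0 M; have := sqr_ge0 c; lra|exact: ltW].
have k0 : 0 < k%:R :> R by have := normr_ge0 c; lra.
have kne : k%:R != 0 :> R by rewrite gt_eqF.
have ke : M ^+ 2 + 2 * c ^+ 2 <= e * k%:R.
  by rewrite -ler_pdivrMl// mulrC; have := normr_ge0 c; lra.
have kc : 2 * `|c| < k%:R by have := normr_ge0 c; lra.
pose v0 : F := fun t => 1 + Complex k%:R^-1 0 * P t.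
have mv0 : multiplier v0.
  apply: multiplierD; first exact: multiplier_cst.
  by apply: multiplierM => //; exact: multiplier_cst.
have [mv cv] := multiplierX k mv0.
exists (fun t => v0 t ^+ k); split=> //.
- move=> t; rewrite cabsX -ler_sqr ?nnegrE ?exprn_ge0 ?cabs_ge0 ?expR_ge0//.
  rewrite exprAC cabs_sqr /v0 !(ReD, ImD, ReM, ImM, Re1, Im1, ReX, ImX) PE.
  set y := Im (P t).
  have Py : p t ^+ 2 + y ^+ 2 <= M ^+ 2.
    by rewrite -PE -cabs_sqr ler_sqr ?nnegrE ?cabs_ge0.
  rewrite -!expRM_natl.
  apply: (@le_trans _ _ (expR (k%:R^-1 * (2 * (p t + e))) ^+ k)); last first.
    by rewrite -expRM_natl mulrA divff// mul1r.
  apply: lerXn2r; rewrite ?nnegrE ?expR_ge0 ?addr_ge0 ?sqr_ge0//.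
  apply: le_trans (expR_ge1Dx _); rewrite -subr_ge0.
  (* |1 + P/k|^2 = 1 + 2p/k + |P|^2/k^2, and the last term is at most 2e/k by the choice of k. *)
  rewrite (_ : _ - _ = k%:R^-1 ^+ 2 * (2 * e * k%:R - (p t ^+ 2 + y ^+ 2))); last by field.
  rewrite mulr_ge0 ?sqr_ge0//; have := sqr_ge0 c.
  have : 0 <= e * k%:R by apply: mulr_ge0; exact: ltW.
  by have := sqr_ge0 M; lra.
- rewrite cv /v0 cintD; [|exact: Hinf_L1 (Hinf_cst 1)|]; last first.
    by apply: Hinf_L1; apply: HinfZ; case: mP.
  rewrite cint_cst cintZ ?cP; last by apply: Hinf_L1; case: mP.
  rewrite (_ : _ ^+ k = Complex ((1 + c / k%:R) ^+ k) 0); last first.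
    rewrite -[RHS]/(real_complex R _) rmorphXn; congr (_ ^+ _).
    by apply: complexP; rewrite !(ReD, ImD, ReM, ImM, Re1, Im1, ReX, ImX) /=; ring.
  rewrite ReX; set y := c / k%:R.
  have yb : `|y| <= 2^-1.
    by rewrite /y normrM normfV (ger0_norm (ltW k0)) ler_pdivrMr//; lra.
  have [y1 y2] : - 2^-1 <= y /\ y <= 2^-1 by move: yb; rewrite ler_norml => /andP[].
  apply: (@le_trans _ _ (expR (y / (1 + y)) ^+ k)); last first.
    apply: lerXn2r; rewrite ?nnegrE ?expR_ge0//; first by lra.
    by apply: expR_frac_le; lra.
  rewrite -expRM_natl ler_expR.
  have cy : c = k%:R * y by rewrite /y; field.
  (* The loss k y^2 / (1 + y) is at most 2 k y^2 = 2 c^2 / k <= e, since 1 + y >= 1/2. *)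
  rewrite (_ : k%:R * _ = c - k%:R * y ^+ 2 / (1 + y)); last by rewrite cy; field; lra.
  rewrite lerD2l lerN2 ler_pdivrMr; last by lra.
  have h1 : 2 * (k%:R * y) ^+ 2 <= e * k%:R by rewrite -cy; have := sqr_ge0 M; lra.
  have h2 : k%:R * (2 * (k%:R * y ^+ 2)) <= k%:R * e.
    by rewrite [leRHS]mulrC (_ : k%:R * (2 * _) = 2 * (k%:R * y) ^+ 2)//; ring.
  rewrite ler_pM2l// in h2.
  apply: (@le_trans _ _ (e / 2)); first by lra.
  by rewrite ler_pM2l//; lra.
Qed.

(** Approximating [q] in L^1 at rate 2^-n gives convergence of the polynomials both a.e. and in
    mean, so that the two bounds of [exp_trigpoly] pass to the limit together. *)
Lemma outer_bounded (q : R -> R) (M : R) : mfun q -> aec (fun t => `|q t| <= M) -> 0 < M ->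
  exists v : F, [/\ multiplier v, aec (fun t => cabs (v t) <= expR (q t)) &
    expR (rint q) <= Re (cint v)].
Proof.
move=> mq qM M0; pose h n : R := 2^-1 ^+ n.
have h0 n : 0 < h n by rewrite exprn_gt0.
have h1 n : h n <= 1 by rewrite exprn_ile1//; lra.
have ch : h @ \oo --> (0 : R) := @cvg_half_exp R.
have [p hp] := choice (fun n => trig_dense mq qM M0 (h0 n)).
have [v hv] := choice (fun n => let: And3 tp _ _ := hp n in exp_trigpoly tp (h0 n)).
have Iq : Rintegrable q by exact: Rintegrable_bdd qM.
have Ip n : Rintegrable (p n).
  by have [tp pM _] := hp n; apply: (Rintegrable_bdd (M := M)); [exact: trigpoly_mfun|exact: aecW].
have cp : aec (fun t => p ^~ t @ \oo --> q t).
  have := @summable_ae R (fun n t => `|p n t - q t|) 1.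
  move=> /(_ (fun n => Rintegrable_abs (RintegrableB (Ip n) Iq)) (fun n t _ => normr_ge0 _)) s.
  have {}s := s (fun n => ltac:(rewrite mul1r; by have [] := hp n)).
  apply: aecS s => t _ /cvg_series_cvg_0 c0.
  apply/cvgrPdist_lt => e e0.
  have [N hN] := cvgn0_lt c0 e0; exists N => // n Nn /=.
  by have := hN n Nn; rewrite normr_id distrC.
have cr : rint (p n) @[n --> \oo] --> rint q.
  apply/cvgrPdist_le => e e0; have [N hN] := cvgn0_lt ch e0.
  exists N => // n Nn /=; rewrite distrC -rintB//.
  apply: le_trans (le_rint_abs (RintegrableB (Ip n) Iq)) _.
  have [_ _ le1] := hp n; apply: le_trans le1 _.
  by apply: ltW; have := hN n Nn; rewrite gtr0_norm.
apply: (@multiplier_limit v (fun n t => expR (p n t + h n)) _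
   (fun n => expR (rint (p n) - h n)) _ (expR (M + 1))).
- by move=> n; case: (hv n).
- by move=> n; have [_ vp _] := hv n; exact: aecW.
- move=> n; apply: aecW => t _; rewrite ler_expR; have [_ pM _] := hp n.
  by have := pM t; have := ler_norm (p n t); have := h1 n; lra.
- apply: aecS cp => t _ ct; rewrite -[X in expR X]addr0.
  by apply: continuous_cvg; [exact: continuous_expR|exact: cvgD].
- by move=> n; case: (hv n).
- rewrite -[X in expR X]subr0.
  by apply: continuous_cvg; [exact: continuous_expR|exact: cvgB].
Qed.

(** Truncating [l] at k + 1 only raises the mean of its negative, so one lower bound serves all
    truncations, and at each point the truncation is eventually exact. *)
Lemma outer_integrable (l : R -> R) : Rintegrable l -> aec (fun t => 0 <= l t) ->
  exists v : F, [/\ multiplier v, aec (fun t => cabs (v t) <= expR (- l t)) &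
    expR (- rint l) <= Re (cint v)].
Proof.
move=> Il l0; have ml := Rintegrable_mfun Il.
pose q (k : nat) t := - Num.min (l t) k.+1%:R.
have mq k : mfun (q k).
  by apply: measurableT_comp => //; apply: measurable_minr => //; exact: measurable_cst.
have qM k : aec (fun t => `|q k t| <= k.+1%:R).
  apply: aecS l0 => t _ lt0; rewrite normrN ger0_norm; first by rewrite ge_min lexx orbT.
  by rewrite le_min lt0 ler0n.
have k0 k : 0 < k.+1%:R :> R by rewrite ltr0n.
have [v hv] := choice (fun k => outer_bounded (mq k) (qM k) (k0 k)).
apply: (@multiplier_limit v (fun n t => expR (q n t)) _ (fun=> expR (- rint l)) _ 1).
- by move=> n; case: (hv n).
- by move=> n; case: (hv n).
- move=> n; apply: aecS l0 => t _ lt0.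
  by rewrite -[leRHS]expR0 ler_expR oppr_le0 le_min lt0 ler0n.
- apply: aecW => t _; apply: cvg_near_cst; exists (Num.trunc (l t)) => // n /= Nn.
  by rewrite /q min_l//; apply: le_trans (ltW (truncnS_gt _)) _; rewrite ler_nat.
- move=> n; have [_ _] := hv n; apply: le_trans; rewrite ler_expR -[leLHS]mulN1r -rintZ//.
  apply: le_rint; [exact: RintegrableZ|exact: Rintegrable_bdd (qM n)|].
  by apply: aecW => t _; rewrite mulN1r lerN2 ge_min lexx.
- exact: cvg_cst.
Qed.

End Outer.

(** * Integrability of log (1 - |h|) *)

Section LogIntegrability.
Variable R : realType.
Local Notation D := (@circ R).
Local Notation Re := complex.Re.
Local Notation Im := complex.Im.
Local Notation F := (R -> R[i]).

(** The integral of r^2 equals that of r (r - p) for any [p], which is at most N times the L^1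
    distance from [p] to [r]. *)
Lemma trig_complete_real (r : R -> R) (M : R) : mfun r -> aec (fun t => `|r t| <= M) ->
  (forall p, trigpoly p -> rint (fun t => r t * p t) = 0) -> aec (fun t => r t = 0).
Proof.
move=> mr rM0 rp.
pose N := Num.max M 1.
have N0 : 0 < N by rewrite lt_max ltr01 orbT.
have rM : aec (fun t => `|r t| <= N) by apply: aecS rM0 => t _ h; rewrite le_max h.
have I2 f g (K L : R) : mfun f -> mfun g -> aec (fun t => `|f t| <= K) ->
    aec (fun t => `|g t| <= L) -> Rintegrable (fun t => f t * g t).
  move=> mf mg fK gL; apply: (Rintegrable_bdd (M := K * L)); first exact: measurable_funM.
  by apply: aecS (aecI fK gL) => t _ [a b]; rewrite normrM ler_pM.
have Ir2 : Rintegrable (fun t => r t * r t) by exact: (I2 _ _ _ _ mr mr rM rM).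
have : aec (fun t => r t * r t = 0).
  apply: rint_eq0 => //; first by apply: aecW => t _; rewrite -expr2 sqr_ge0.
  apply/ler_addgt0Pr => e e0; rewrite add0r.
  have e1 : 0 < e / N by rewrite divr_gt0.
  have [p [tp pN hp]] := trig_dense mr rM N0 e1.
  have mp := trigpoly_mfun tp.
  have pN' : aec (fun t => `|p t| <= N) by exact: aecW.
  have Irp : Rintegrable (fun t => r t * p t) by exact: (I2 _ _ _ _ mr mp rM pN').
  rewrite -[leLHS]subr0 -(rp _ tp) -rintB//.
  have Id : Rintegrable (fun t => `|p t - r t|).
    apply: Rintegrable_abs.
    by apply: RintegrableB; [exact: Rintegrable_bdd pN'|exact: Rintegrable_bdd rM].
  apply: (@le_trans _ _ (rint (fun t => N * `|p t - r t|))).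
    apply: le_rint; [exact: RintegrableB|exact: RintegrableZ|].
    apply: aecS rM => t _ h; rewrite -mulrBr.
    apply: le_trans (ler_norm _) _; rewrite normrM distrC.
    exact: ler_wpM2r.
  by rewrite rintZ// mulrC -ler_pdivlMr.
by apply: aecS => t _ /eqP; rewrite mulf_eq0 orbb => /eqP.
Qed.

Lemma fourier_eq0 (g : F) : Linf g -> (forall k, fourier g k = 0) -> aec (fun t => g t = 0).
Proof.
move=> gL g0.
have z k : cint (fun t => zeta_pow k t * g t) = 0.
  by have := g0 (- k); rewrite fourierE opprK.
have gz (c : R[i]) k : L1 (fun t => c * (zeta_pow k t * g t)).
  apply: Linf_L1; apply: LinfM; first exact: Linf_cst.
  by apply: LinfM => //; exact: Linf_zeta.
(* Pairing k with -k yields the real and imaginary parts of zeta^k as test functions, after which Re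
   g and Im g can be treated separately. *)
have zz (c c' : R[i]) k :
    cint (fun t => c * (zeta_pow k t * g t) + c' * (zeta_pow (- k) t * g t)) = 0.
  rewrite cintD; [|exact: gz..].
  by rewrite !cintZ; [rewrite !z !mulr0 addr0|exact: L1_zetaM..].
have tp p : trigpoly p ->
    Linf (fun t => Complex (p t) 0 : R[i]) /\ cint (fun t => Complex (p t) 0 * g t) = 0.
  elim=> [k|k|f1 f2 _ [l1 i1] _ [l2 i2]|c f1 _ [l1 i1]].
  - split.
      have [[m1 m2] _] := @Linf_zeta R k; split; first by split=> //; exact: measurable_cst.
      by exists 1; apply: aecW => t _; rewrite cabs_real (le_trans (Re_cabs _))// cabs_zeta.
    rewrite -(zz 2^-1 2^-1 k); apply: eq_cint => t; rewrite -zeta_conj -mulrDr -mulrDl mulrA.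
    congr (_ * _); rewrite (invn_complex R 2).
    by apply: complexP; rewrite !(ReM, ImM, ReD, ImD, ReJ, ImJ, ReX, ImX); field.
  - split.
      have [[m1 m2] _] := @Linf_zeta R k; split; first by split=> //; exact: measurable_cst.
      by exists 1; apply: aecW => t _; rewrite cabs_real (le_trans (Im_cabs _))// cabs_zeta.
    rewrite -(zz (Complex 0 (- 2^-1)) (Complex 0 2^-1) k); apply: eq_cint => t.
    rewrite -zeta_conj !mulrA -mulrDl; congr (_ * _).
    by apply: complexP; rewrite !(ReM, ImM, ReD, ImD, ReJ, ImJ, ReX, ImX); field.
  - have E t : Complex (f1 t + f2 t) 0 = Complex (f1 t) 0 + Complex (f2 t) 0 :> R[i].
      by apply: complexP; rewrite !(ReD, ImD, ReX, ImX) ?addr0.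
    under eq_fun do rewrite E; split; first exact: LinfD.
    rewrite (@eq_cint _ _ (fun t => Complex (f1 t) 0 * g t + Complex (f2 t) 0 * g t)); last first.
      by move=> t; rewrite E mulrDl.
    by rewrite cintD ?i1 ?i2 ?addr0//; apply: LinfM_L1 => //; exact: Linf_L1.
  - have E t : Complex (c * f1 t) 0 = Complex c 0 * Complex (f1 t) 0 :> R[i].
      by apply: complexP; rewrite !(ReM, ImM, ReX, ImX); ring.
    under eq_fun do rewrite E; split; first by apply: LinfM => //; exact: Linf_cst.
    rewrite (@eq_cint _ _ (fun t => Complex c 0 * (Complex (f1 t) 0 * g t))); last first.
      by move=> t; rewrite E mulrA.
    by rewrite cintZ ?i1 ?mulr0//; apply: LinfM_L1 => //; exact: Linf_L1.
have [[mg1 mg2] [M gM]] := gL.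
have r1 : aec (fun t => Re (g t) = 0).
  apply: (@trig_complete_real _ M) => //.
    by apply: aecS gM => t _; apply: le_trans; exact: Re_cabs.
  move=> p /tp[_] /(congr1 (@Re R)) /= <-; apply: eq_rint => t _.
  by rewrite ReM /= mul0r subr0 mulrC.
have r2 : aec (fun t => Im (g t) = 0).
  apply: (@trig_complete_real _ M) => //.
    by apply: aecS gM => t _; apply: le_trans; exact: Im_cabs.
  move=> p /tp[_] /(congr1 (@Im R)) /= <-; apply: eq_rint => t _.
  by rewrite ImM /= mul0r addr0 mulrC.
by apply: aecS (aecI r1 r2) => t _ [a b]; apply: complexP.
Qed.

(** The mean of [g] may vanish. Dividing by the power of zeta at its first nonzero coefficient
    repairs this without changing the modulus. *)
Lemma first_fourier_coef (g : F) : Hinf g -> ~ aec (fun t => g t = 0) ->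
  exists k : int, Hinf (fun t => zeta_pow k t * g t) /\ cint (fun t => zeta_pow k t * g t) != 0.
Proof.
move=> [gL gneg] gn0.
have ex : exists n : nat, `[< fourier g n <> 0 >].
  apply: contrapT => h; apply: gn0; apply: fourier_eq0 => // -[n|n]; last exact: gneg.
  by apply: contrapT => hn; apply: h; exists n; apply/asboolP.
case: (ex_minnP ex) => n /asboolP hn minn.
exists (- n%:Z); split.
  split; first by apply: LinfM => //; exact: Linf_zeta.
  move=> k k0; rewrite fourier_shift opprK.
  (* The shifted index lies below n: it is negative, or excluded by minimality of n. *)
  case E : (k + n%:Z) => [m|m]; last exact: gneg.
  apply: contrapT => hm; have /minn : `[< fourier g m <> 0 >] by apply/asboolP.
  by rewrite leqNgt -ltz_nat -E gtrDr k0.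
by apply/eqP; rewrite -fourierE.
Qed.

(* The log of a majorant of |g| has an integral bounded below: multiply g by an outer function
   of modulus at most the inverse of the majorant. *)
Lemma log_majorant_bound (g : F) : Hinf g -> ~ aec (fun t => g t = 0) ->
  exists K : R, forall (q : R -> R) (M : R), 0 < M -> mfun q -> aec (fun t => `|q t| <= M) ->
    aec (fun t => cabs (g t) <= expR (q t)) -> - K <= rint q.
Proof.
move=> hg gn0; have [k [hg' ig']] := first_fourier_coef hg gn0.
set g' := fun t => _ in hg' ig'.
set a := cabs (cint g').
have a0 : 0 < a.
  rewrite lt_neqAle cabs_ge0 andbT eq_sym; apply: contra ig' => /eqP /cabs_eq0 ->.
  exact: eqxx.
(* From |mean u| a <= 2 and mean u >= exp (- mean q), where the 2 is that of [cint_le2]. *)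
exists (ln (2 / a)) => q M M0 mq qM gq.
have mnq : mfun (fun t => - q t) by exact: measurableT_comp.
have qM' : aec (fun t => `|- q t| <= M) by apply: aecS qM => t _; rewrite normrN.
have [u [mu_ uq iu]] := outer_bounded mnq qM' M0.
have [h1 h2] := mu_.2 _ hg'.
have h3 : cabs (cint (fun t => u t * g' t)) <= 2 * 1.
  apply: cint_le2; first by case: h1 => -[].
  apply: aecS (aecI uq gq) => t _ [x1 x2]; rewrite !cabsM cabs_zeta mul1r.
  rewrite -(expRxMexpNx_1 (q t)) mulrC.
  by apply: ler_pM; rewrite ?cabs_ge0.
have iq : rint (fun t => - q t) = - rint q.
  rewrite -mulN1r -rintZ; last exact: Rintegrable_bdd qM.
  by apply: eq_rint => t _; rewrite mulN1r.
rewrite h2 cabsM mulr1 -/a in h3.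
rewrite lerNl -ler_expR lnK ?posrE ?divr_gt0//.
rewrite -iq ler_pdivlMr//; apply: le_trans h3; apply: ler_wpM2r; first exact: ltW.
by apply: le_trans iu _; apply: le_trans (ler_norm _) (Re_cabs _).
Qed.

(** The floor exp (-n) makes this bounded between -n and 0 for every [h], even where |h| >= 1, and
    it decreases to [log1m_abs h] as n grows. *)
Definition logtrunc (h : F) (n : nat) (t : R) : R :=
  ln (Num.max (1 - cabs (h t)) (expR (- n%:R))).

Lemma logtrunc_max_gt0 (h : F) n t : 0 < Num.max (1 - cabs (h t)) (expR (- n%:R)).
Proof. by rewrite lt_max expR_gt0 orbT. Qed.

Lemma logtrunc_bnd (h : F) n t : - n%:R <= logtrunc h n t <= 0.
Proof.
apply/andP; split.
  by rewrite -[leLHS]expRK ler_ln ?posrE ?expR_gt0 ?logtrunc_max_gt0// le_max lexx orbT.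
rewrite -ln1 ler_ln ?posrE ?logtrunc_max_gt0// ge_max.
by rewrite -[X in _ && (_ <= X)]expR0 ler_expR oppr_le0 ler0n andbT; have := cabs_ge0 (h t); lra.
Qed.

Lemma logtrunc_noninc (h : F) t m n : (m <= n)%N -> logtrunc h n t <= logtrunc h m t.
Proof.
move=> mn; rewrite ler_ln ?posrE ?logtrunc_max_gt0// ge_max !le_max lexx /=.
by rewrite ler_expR lerN2 ler_nat mn orbT.
Qed.

Lemma logtrunc_cvg (h : F) t : (logtrunc h n t)%:E @[n --> \oo] --> log1m_abs h t.
Proof.
rewrite /log1m_abs; case: ifPn => [h1|].
  apply: cvg_near_cst; pose w := 1 - cabs (h t).
  have w0 : 0 < w by rewrite subr_gt0.
  exists (Num.trunc (- ln w)).+1 => // n /= nn; congr EFin; rewrite /logtrunc max_l//.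
  rewrite -[leRHS]lnK ?posrE// ler_expR lerNl.
  by apply: le_trans (ltW (truncnS_gt _)) _; rewrite ler_nat.
rewrite -leNgt => h1.
apply/cvgeNyPle => A; exists (Num.trunc (- A)).+1 => // n /= nn.
rewrite lee_fin /logtrunc max_r; last by apply: le_trans (expR_ge0 _); lra.
rewrite expRK lerNl; apply: le_trans (ltW (truncnS_gt _)) _.
by rewrite ler_nat.
Qed.

Lemma mfun_logtrunc (h : F) n : cmeas h -> mfun (logtrunc h n).
Proof.
move=> mh; apply: measurableT_comp; first exact: measurable_ln.
apply: measurable_maxr; last exact: measurable_cst.
by apply: measurable_funB; [exact: measurable_cst|exact: mfun_cabs].
Qed.

Lemma Rintegrable_logtrunc (h : F) n : cmeas h -> Rintegrable (logtrunc h n).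
Proof.
move=> mh; apply: (Rintegrable_bdd (M := n%:R)); first exact: mfun_logtrunc.
apply: aecW => t _; have /andP[a b] := logtrunc_bnd h n t.
by rewrite ler0_norm// lerNl.
Qed.

Lemma emeas_log1m (h : F) : cmeas h -> measurable_fun D (log1m_abs h).
Proof.
move=> mh; apply: (@emeasurable_fun_cvg _ _ _ D (fun n t => (logtrunc h n t)%:E)).
  by move=> n; apply/measurable_EFinP; exact: mfun_logtrunc.
by move=> t _; exact: logtrunc_cvg.
Qed.

(** Monotone convergence for the negatives of the truncations, whose pointwise limit is |log (1 -
    |h|)|, possibly infinite. *)
Lemma log1m_abs_L1_bnd (h : F) (C : R) : cmeas h ->
  (forall n, - C <= rint (logtrunc h n)) -> log1m_abs_L1 h.
Proof.
move=> mh hC; apply/integrableP; split; first exact: emeas_log1m.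
have In n := Rintegrable_logtrunc n mh.
pose g n t : \bar R := (- logtrunc h n t)%:E.
have mg n : measurable_fun D (g n).
  by apply/measurable_EFinP; apply: measurableT_comp => //; exact: mfun_logtrunc.
have g0 n t : D t -> (0 <= g n t)%E.
  by rewrite lee_fin oppr_ge0; have /andP[] := logtrunc_bnd h n t.
have ng t : D t -> {homo g ^~ t : n m / (n <= m)%N >-> (n <= m)%E}.
  by move=> _ n m nm; rewrite lee_fin lerN2; exact: logtrunc_noninc.
have lg t : limn (g ^~ t) = `|log1m_abs h t|%E.
  apply: cvg_lim => //.
  have le0 : (log1m_abs h t <= 0)%E.
    rewrite /log1m_abs; case: ifPn => [h1|_]; last exact: leNye.
    by rewrite lee_fin ln_le0//; have := cabs_ge0 (h t); lra.
  rewrite lee0_abs//; apply: (@cvgeN _ _ _ _ (fun n => (logtrunc h n t)%:E)) => //.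
  exact: logtrunc_cvg.
under eq_integral do rewrite -lg.
apply: (@le_lt_trans _ _ C%:E); last exact: ltry.
have cv := @cvg_monotone_convergence _ _ R lebesgue_measure D (@lmeasurable_circ R) g mg g0 ng.
rewrite -(cvg_lim _ cv)//; apply: lime_le; first by apply/cvg_ex; eexists; exact: cv.
apply: nearW => n.
have If : Rintegrable (fun t => - logtrunc h n t).
  by have := RintegrableZ (-1) (In n); under eq_fun do rewrite mulN1r.
have fi := integrable_fin_num (@lmeasurable_circ R) If.
rewrite -[leLHS]fineK// lee_fin.
rewrite -[leLHS]/(rint (fun t => - logtrunc h n t)).
rewrite (@eq_rint _ _ (fun t => -1 * logtrunc h n t)); last by move=> t _; rewrite mulN1r.
by rewrite rintZ// mulN1r lerNl.
Qed.

Lemma sqr_cabs_DB (a b : R[i]) :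
  cabs (a + b) ^+ 2 + cabs (a - b) ^+ 2 = 2 * (cabs a ^+ 2 + cabs b ^+ 2).
Proof. by rewrite !cabs_sqr !(ReD, ImD, ReN, ImN); ring. Qed.

(* |g|^2 <= 1 - |h|^2 <= 2 (1 - |h|) by the parallelogram law. *)
Lemma log1m_abs_L1_perturb (h g : F) : cmeas h -> Hinf g ->
  aec (fun t => cabs (h t + g t) <= 1) -> aec (fun t => cabs (h t - g t) <= 1) ->
  ~ aec (fun t => g t = 0) -> log1m_abs_L1 h.
Proof.
move=> mh hg b1 b2 gn0.
have [K hK] := log_majorant_bound hg gn0.
apply: (@log1m_abs_L1_bnd _ (2 * K + ln 2)) => // n.
(* Half the logarithm of 2 max (1 - |h|, exp (-n)), a majorant of log |g|. Solving -K <= mean of q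
   for the mean of [logtrunc] gives the constant 2 K + ln 2. *)
pose q t := 2^-1 * (ln 2 + logtrunc h n t).
have ml := mfun_logtrunc n mh.
have l2 : 0 < ln 2 :> R by rewrite ln_gt0// ltr1n.
have mq : mfun q.
  apply: measurable_funM; first exact: measurable_cst.
  by apply: measurable_funD => //; exact: measurable_cst.
have qM : aec (fun t => `|q t| <= ln 2 + n%:R).
  apply: aecW => t _; have /andP[x1 x2] := logtrunc_bnd h n t.
  rewrite /q ler_norml; have : 0 <= n%:R :> R by []; lra.
have M0 : 0 < ln 2 + n%:R :> R by have : 0 <= n%:R :> R by []; lra.
have gq : aec (fun t => cabs (g t) <= expR (q t)).
  apply: aecS (aecI b1 b2) => t _ [x1 x2].
  rewrite -ler_sqr ?nnegrE ?cabs_ge0 ?expR_ge0// -expRM_natl /q mulrA divff// mul1r.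
  rewrite expRD !lnK ?posrE ?logtrunc_max_gt0//.
  apply: (@le_trans _ _ (2 * (1 - cabs (h t)))); last first.
    by rewrite ler_pM2l// le_max lexx.
  have := sqr_cabs_DB (h t) (g t).
  have := cabs_ge0 (h t + g t); have := cabs_ge0 (h t - g t).
  have := cabs_ge0 (h t); have := sqr_ge0 (cabs (g t)).
  set A := cabs (h t + g t) in x1 *; set B := cabs (h t - g t) in x2 *.
  set H := cabs (h t); set G2 := cabs (g t) ^+ 2.
  move=> G0 H0 B0 A0 e.
  have A2 : A ^+ 2 <= 1 by rewrite expr_le1.
  have B2 : B ^+ 2 <= 1 by rewrite expr_le1.
  have H1 : H ^+ 2 <= 1 by lra.
  have H1' : H <= 1 by rewrite -(@expr_le1 _ 2).
  have : 0 <= (1 - H) * (1 - H) by rewrite -expr2 sqr_ge0.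
  nra.
have := hK q _ M0 mq qM gq.
have Il := Rintegrable_logtrunc n mh.
rewrite /q rintZ; last by apply: RintegrableD => //; exact: Rintegrable_cst.
rewrite rintD//; last exact: Rintegrable_cst.
rewrite rint_cst; lra.
Qed.

End LogIntegrability.

(** * The quotient by a weak-star closed subspace *)

Section Quotient.
Variable R : realType.
Local Notation mu := (@leb R).
Local Notation D := (@circ R).
Local Notation Re := complex.Re.
Local Notation F := (R -> R[i]).
Variable E : set F.
Hypothesis subE : subspace_Hinf E.
Hypothesis wsE : weakstar_closed E.

Lemma E_Hinf f : E f -> Hinf f. Proof. by case: subE => h _ _ _ _; exact: h. Qed.
Lemma E0 : E (fun=> 0). Proof. by case: subE. Qed.
Lemma ED f g : E f -> E g -> E (fun t => f t + g t).
Proof. by case: subE => _ _ h _ _; exact: h. Qed.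
Lemma EZ (c : R[i]) f : E f -> E (fun t => c * f t).
Proof. by case: subE => _ _ _ h _; exact: h. Qed.
Lemma Eae f g : E f -> Hinf g -> aec (fun t => f t = g t) -> E g.
Proof. by case: subE => _ _ _ _ h; exact: h. Qed.

Lemma E_ext f g : (forall t, f t = g t) -> E f -> E g.
Proof. by move=> h; rewrite (_ : g = f)//; apply/funext => t; rewrite h. Qed.

Lemma Hinf_ext (f g : F) : (forall t, f t = g t) -> Hinf f -> Hinf g.
Proof. by move=> h; rewrite (_ : g = f)//; apply/funext => t; rewrite h. Qed.

Lemma EN f : E f -> E (fun t => - f t).
Proof. by move=> /(EZ (-1)); apply: E_ext => t; rewrite mulN1r. Qed.

(** A neighbourhood of [w] missing [E] involves finitely many functionals; along the sequence each
    pairing tends to 0, so a common late index contradicts it. *)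
Lemma weakstar_lim (e : nat -> F) (w : F) (M : R) : (forall n, E (e n)) -> cmeas w ->
  aec (fun t => forall n, cabs (e n t) <= M) -> aec (fun t => ccvg (e ^~ t) (w t)) -> E w.
Proof.
move=> Ee mw eM ce.
have me n : cmeas (e n) by have [[]] := E_Hinf (Ee n).
have hw : Hinf w by apply: Hinf_lim eM ce => // n; exact: E_Hinf.
apply: contrapT => /(wsE hw)[n [phi [eps [eps0 Lphi hphi]]]].
have small (i : 'I_n) : exists N, forall m, (N <= m)%N ->
    cabs (cint (fun t => (e m t - w t) * phi i t)) < eps.
  have cv : ccvg (fun m => cint (fun t => e m t * phi i t) - cint (fun t => w t * phi i t)) 0.
    rewrite -(subrr (cint (fun t => w t * phi i t))).
    by apply: ccvgD; [exact: cint_dct eM ce|exact: ccvg_cst].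
  have := ccvg_cabs cv; rewrite cabs0 => /cvgn0_lt /(_ eps0)[N hN].
  exists N => m Nm; have := hN m Nm; rewrite ger0_norm ?cabs_ge0//.
  rewrite -(_ : cint (fun t => (e m t - w t) * phi i t) =
    cint (fun t => e m t * phi i t) - cint (fun t => w t * phi i t))//.
  rewrite (@eq_cint _ _ (fun t => e m t * phi i t + -1 * (w t * phi i t))); last first.
    by move=> t; rewrite mulN1r mulrBl.
  have L2 : L1 (fun t => w t * phi i t) by apply: LinfM_L1 => //; case: hw.
  rewrite cintD ?cintZ ?mulN1r//.
    by apply: LinfM_L1 => //; case: (E_Hinf (Ee m)).
  by apply: (@LinfM_L1 _ (fun=> -1)) => //; exact: Linf_cst.
have [N hN] := choice small.
have [j] := hphi _ (Ee (\max_(i < n) N i)%N).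
by rewrite leNgt hN//; exact: leq_bigmax.
Qed.

Lemma normInf_le (f : F) (M : R) : 0 <= M -> aec (fun t => cabs (f t) <= M) -> normInf f <= M.
Proof.
move=> M0 fM; apply: ge_inf; last by split.
by exists 0 => x [].
Qed.

Lemma normInf_ge0 (f : F) : Linf f -> 0 <= normInf f.
Proof.
move=> [_ [M fM]]; apply: lb_le_inf; last by move=> x [].
exists (Num.max 0 M); split; first by rewrite le_max lexx.
by apply: aecS fM => t _ h; rewrite le_max h orbT.
Qed.

(** The infimum is attained: intersect the countably many full-measure sets for the bounds M +
    1/(n+1). *)
Lemma normInf_bnd (f : F) (M : R) : Linf f -> normInf f <= M -> aec (fun t => cabs (f t) <= M).
Proof.
move=> [_ [K fK]] fM.
have hi : has_inf [set M : R | 0 <= M /\ {ae mu, forall t, D t -> cabs (f t) <= M}].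
  split; last by exists 0 => x [].
  exists (Num.max 0 K); split; first by rewrite le_max lexx.
  by apply: aecS fK => t _ h; rewrite le_max h orbT.
have h n : aec (fun t => cabs (f t) <= M + n.+1%:R^-1).
  have n0 : 0 < n.+1%:R^-1 :> R by rewrite invr_gt0.
  have [x [x0 fx] xlt] := inf_adherent n0 hi.
  apply: (@aecS _ (fun t => cabs (f t) <= x)); last exact: fx.
  move=> t _ ft; apply: le_trans ft _; apply: ltW; apply: lt_le_trans xlt _.
  by rewrite lerD2r.
apply: aecS (aec_forall h) => t _ ht; apply/ler_addgt0Pr => e e0.
apply: le_trans (ht (Num.trunc e^-1)) _; rewrite lerD2l.
rewrite -[leRHS]invrK lef_pV2 ?posrE ?invr_gt0//.
exact: ltW (truncnS_gt _).
Qed.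

Lemma qnorm_le (g xi : F) : Hinf g -> Hinf xi -> E (fun t => xi t - g t) ->
  qnorm E g <= normInf xi.
Proof.
move=> hg hxi Ex; apply: ge_inf; last first.
  exists (fun t => xi t - g t) => //; congr normInf; apply/funext => t.
  by rewrite addrC subrK.
exists 0 => _ [e Ee <-]; apply: normInf_ge0.
by have [] := HinfD hg (E_Hinf Ee).
Qed.

Lemma qnorm_attained (g : F) : Hinf g -> qnorm E g <= 1 ->
  exists g', [/\ Hinf g', E (fun t => g' t - g t) & aec (fun t => cabs (g' t) <= 1)].
Proof.
move=> hg qg.
have step (n : nat) : exists v, [/\ Hinf v, E (fun t => v t - g t) &
    aec (fun t => cabs (v t) <= 1 + 2^-1 ^+ n)].
  have e0 : 0 < 2^-1 ^+ n :> R by rewrite exprn_gt0.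
  have hi : has_inf [set normInf (fun t => g t + e t) | e in E].
    split; first by exists (normInf (fun t => g t + 0)); exists (fun=> 0) => //; exact: E0.
    exists 0 => _ [e Ee <-]; apply: normInf_ge0.
    by have [] := HinfD hg (E_Hinf Ee).
  have [_ [e Ee <-] le] := inf_adherent e0 hi.
  have hge := HinfD hg (E_Hinf Ee).
  exists (fun t => g t + e t); split=> //.
    by apply: E_ext Ee => t; rewrite addrAC subrr add0r.
  apply: normInf_bnd; first by case: hge.
  by apply: ltW; apply: lt_le_trans le _; rewrite lerD2r.
have [v hv] := choice step.
have ch : 1 + 2^-1 ^+ n @[n --> \oo] --> (1 : R).
  rewrite -[X in _ --> X]addr0; apply: cvgD; first exact: cvg_cst.
  exact: cvg_half_exp.
have mv n : cmeas (v n) by have [[[]]] := hv n.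
have v2 n : aec (fun t => cabs (v n t) <= 2).
  have [_ _ h] := hv n; apply: aecS h => t _ h; apply: le_trans h _.
  have : 2^-1 ^+ n <= 1 :> R by rewrite exprn_ile1//; lra.
  lra.
have [u [w [hu mw cu]]] := mazur mv v2.
have uE n : E (fun t => u n t - g t).
  apply: (hu n (fun f => E (fun t => f t - g t))); last by move=> m _; case: (hv m).
  move=> a b Ea Eb; apply: E_ext (EZ 2^-1 (ED Ea Eb)) => t.
  by field.
have u2 : aec (fun t => forall n, cabs (u n t) <= 2).
  apply: aec_forall => n.
  by have [] := hu n _ (@midconvex_bdd R 2) (fun m _ => conj (mv m) (v2 m)).
have mu_ n : cmeas (u n).
  by have [] := hu n _ (@midconvex_bdd R 2) (fun m _ => conj (mv m) (v2 m)).
have [[mg [K gK]] _] := hg.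
have Ew : E (fun t => w t - g t).
  apply: (@weakstar_lim (fun n t => u n t - g t) _ (2 + K)) => //.
  - have := cmeasD mw (cmeasM (cmeas_cst (-1)) mg).
    by under eq_fun do rewrite mulN1r.
  - apply: aecS (aecI u2 gK) => t _ [a b] n; apply: le_trans (cabsD _ _) _.
    by rewrite cabsN lerD.
  - by apply: aecS cu => t _ h; apply: ccvgD => //; exact: ccvg_cst.
exists w; split=> //.
  by apply: Hinf_ext (HinfD (E_Hinf Ew) hg) => t; rewrite subrK.
(* Since [u n] combines only terms of the tail, the bound in the limit is 1 and not 2. *)
apply: (hull_aec_le (B := fun n _ => 1 + 2^-1 ^+ n) hu _ _ cu); last exact: aecW.
by move=> n; case: (hv n).
Qed.

Lemma E_full (h : F) : Hinf h -> log1m_abs_L1 h ->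
  (forall G, Hinf G -> aec (fun t => cabs (G t) <= 1 - cabs (h t)) -> E G) ->
  forall g, Hinf g -> E g.
Proof.
move=> hh lh hG g hg.
have mh : cmeas h by case: hh => -[].
(* [log1m_abs] is infinite elsewhere, and an integrable function is finite a.e. *)
have h1 : aec (fun t => cabs (h t) < 1).
  have := integrable_ae (@lmeasurable_circ R) lh; rewrite /aec; apply: filterS => t ht Dt.
  by have := ht Dt; rewrite /log1m_abs; case: ifP.
pose l t := - ln (1 - cabs (h t)).
have ml : mfun l.
  apply: measurableT_comp => //; apply: measurableT_comp; first exact: measurable_ln.
  by apply: measurable_funB; [exact: measurable_cst|exact: mfun_cabs].
have Il : Rintegrable l.
  apply: (le_integrable (@lmeasurable_circ R) _ _ lh); first exact/measurable_EFinP.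
  move=> t _; rewrite /log1m_abs /l /=; case: ifPn => [_|]; first by rewrite normrN.
  by move=> _; exact: leey.
(* Chosen so that exp (- ln_k) = min (1, (k + 1)(1 - |h|)) almost everywhere. These functions tend
   to 0 under the integrable majorant [l]. *)
pose ln_ (k : nat) t := Num.max 0 (l t - ln k.+1%:R).
have lk k : 0 <= ln k.+1%:R :> R by apply: ln_ge0; rewrite ler1n.
have l0 : aec (fun t => 0 <= l t).
  by apply: aecW => t _; rewrite oppr_ge0 ln_le0//; have := cabs_ge0 (h t); lra.
have ln0 k : aec (fun t => 0 <= ln_ k t) by apply: aecW => t _; rewrite le_max lexx.
have mln k : mfun (ln_ k).
  apply: measurable_maxr; first exact: measurable_cst.
  by apply: measurable_funB => //; exact: measurable_cst.
have lnl : aec (fun t => forall k, `|ln_ k t| <= l t).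
  apply: aecS l0 => t _ lt k; rewrite ger0_norm ?le_max ?lexx// ge_max lt /=.
  by have := lk k; lra.
have Iln k : Rintegrable (ln_ k) by apply: Rintegrable_le Il _ => //; apply: aecS lnl => t _; apply.
have cln : rint (ln_ k) @[k --> \oo] --> (0 : R).
  rewrite -[X in _ --> X](rint_cst (0 : R));
  apply: rint_dct Il _ lnl => //; first exact: measurable_cst.
  apply: aecW => t _; apply: cvg_near_cst.
  exists (Num.trunc (expR (l t))) => // n /= nn; rewrite /ln_ max_l//.
  rewrite subr_le0 -[leLHS]expRK ler_ln ?posrE ?expR_gt0 ?ltr0n//.
  by apply: le_trans (ltW (truncnS_gt _)) _; rewrite ler_nat.
have [v hv] := choice (fun k => outer_integrable (Iln k) (ln0 k)).
have [u [w [hu cu mw w1 iw]]] : exists (u : nat -> F) (w : F),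
  [/\ forall n, hull v n (u n), aec (fun t => ccvg (u ^~ t) (w t)),
      multiplier w, aec (fun t => cabs (w t) <= 1) & 1 <= Re (cint w)].
  apply: (@multiplier_mazur _ v (fun _ _ => 1) _ (fun k => expR (- rint (ln_ k))) _ 1).
  - by move=> n; case: (hv n).
  - move=> n; have [_ a _] := hv n; apply: aecS (aecI a (ln0 n)) => t _ [x y].
    by apply: le_trans x _; rewrite -[leRHS]expR0 ler_expR oppr_le0.
  - by move=> n; apply: aecW.
  - by apply: aecW => t _; exact: cvg_cst.
  - by move=> n; case: (hv n).
  - rewrite -[X in _ --> X]expR0 -[X in expR X]oppr0.
    by apply: continuous_cvg; [exact: continuous_expR|exact: cvgN].
have hw : Hinf w by case: mw.
have [IRw IIw] := Hinf_L1 hw.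
(* Re w <= 1 with mean at least 1 forces Re w = 1; then |w| <= 1 leaves no imaginary part. *)
have we1 : aec (fun t => w t = 1).
  have : aec (fun t => 1 - Re (w t) = 0).
    apply: rint_eq0; first by apply: RintegrableB => //; exact: Rintegrable_cst.
      apply: aecS w1 => t _ x; rewrite subr_ge0; apply: le_trans x.
      exact: le_trans (ler_norm _) (Re_cabs _).
    by rewrite rintB ?rint_cst//; [rewrite subr_le0|exact: Rintegrable_cst].
  move=> re1; apply: aecS (aecI re1 w1) => t _ [a b].
  have r1 : Re (w t) = 1 by lra.
  have : cabs (w t) ^+ 2 <= 1 by rewrite expr_le1// cabs_ge0.
  rewrite cabs_sqr r1 expr1n gerDl => i0.
  apply: complexP => //=; apply/eqP; rewrite -sqrf_eq0 eq_le i0 sqr_ge0//.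
have [[mg [K0 gK0]] _] := hg.
pose K := Num.max K0 1.
have K1 : 0 < K by rewrite lt_max ltr01 orbT.
have gK : aec (fun t => cabs (g t) <= K) by apply: aecS gK0 => t _ x; rewrite le_max x.
have vE n : E (fun t => v n t * g t).
  have [mv vl _] := hv n; have [hvg _] := mv.2 _ hg.
  (* Scales |v_n g| <= (n + 1)(1 - |h|) K down to 1 - |h|; linearity of [E] undoes the scaling. *)
  pose c : R := (n.+1%:R * K)^-1.
  have c0 : 0 < c by rewrite invr_gt0 mulr_gt0.
  have EG : E (fun t => Complex c 0 * (v n t * g t)).
    apply: hG; first exact: HinfZ.
    apply: aecS (aecI vl (aecI gK h1)) => t _ [a [b h1t]].
    rewrite !cabsM cabs_real gtr0_norm// ler_pdivrMl ?mulr_gt0//.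
    rewrite mulrAC; apply: ler_pM; rewrite ?cabs_ge0//.
    apply: le_trans a _.
    have w0 : 0 < 1 - cabs (h t) by lra.
    rewrite -[X in _ <= _ * X]lnK ?posrE// -[X in _ <= X * _]lnK ?posrE ?ltr0n//.
    rewrite -expRD ler_expR lerNl le_max; apply/orP; right.
    by rewrite /l; lra.
  apply: E_ext (EZ (Complex c^-1 0) EG) => t; rewrite mulrA.
  rewrite (_ : Complex c^-1 0 * Complex c 0 = 1) ?mul1r//.
  by apply: complexP; rewrite !(ReM, ImM, ReX, ImX, Re1, Im1) ?mulVf ?gt_eqF//; ring.
have v1 n : cmeas (v n) /\ aec (fun t => cabs (v n t) <= 1).
  have [mv a _] := hv n; split; first by have [[[]]] := mv.
  apply: aecS (aecI a (ln0 n)) => t _ [x y].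
  by apply: le_trans x _; rewrite -[leRHS]expR0 ler_expR oppr_le0.
have u1 n := hu n _ (@midconvex_bdd R 1) (fun m _ => v1 m).
have uE n : E (fun t => u n t * g t).
  apply: (hu n (fun f => E (fun t => f t * g t))); last by move=> m _; exact: vE.
  by move=> a b Ea Eb; apply: E_ext (EZ 2^-1 (ED Ea Eb)) => t; field.
have Ew : E (fun t => w t * g t).
  apply: (@weakstar_lim (fun n t => u n t * g t) _ K) => //.
  - by apply: cmeasM => //; case: hw => -[].
  - have ua : aec (fun t => forall n, cabs (u n t) <= 1).
      by apply: aec_forall => n; case: (u1 n).
    apply: aecS (aecI ua gK) => t _ [a b] n; rewrite cabsM -[leRHS]mul1r.
    by apply: ler_pM; rewrite ?cabs_ge0.
  - by apply: aecS cu => t _ x; apply: ccvgM => //; exact: ccvg_cst.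
apply: Eae Ew hg _; apply: aecS we1 => t _ ->; by rewrite mul1r.
Qed.

End Quotient.

Theorem theorem1p3 (R : realType) (E : set (R -> R[i])) (f : R -> R[i]) :
  subspace_Hinf E -> proper_Hinf E -> weakstar_closed E ->
  Hinf f -> qnorm E f = 1 ->
  (extreme_coset E f <->
   exists h : R -> R[i],
     [/\ Hinf h, normInf h = 1, ~ log1m_abs_L1 h & best_approx_unique E f h]).
Proof.
move=> subE [g0 [hg0 nEg0]] wsE hf qf.
have [_ _ Ed Ez Ea] := subE.
have Ext := @E_ext R E.
(* The coset has norm 1, so each of its members in the unit ball is a best approximation. *)
have norm1 (m : R -> R[i]) : Hinf m -> E (fun t => m t - f t) ->
    aec (fun t => cabs (m t) <= 1) -> normInf m = 1.
  move=> hm Em m1; apply/eqP; rewrite eq_le normInf_le ?ler01//= -qf.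
  exact: qnorm_le.
split=> [[_ ext]|[h [hh nh lh [_ Eh _ uniq]]]].
(* Proved for every such representative, not just [h]: uniqueness below applies it to a midpoint. *)
- have noL1 xi : Hinf xi -> E (fun t => xi t - f t) ->
      aec (fun t => cabs (xi t) <= 1) -> ~ log1m_abs_L1 xi.
    move=> hxi Exi xi1 lxi; apply: nEg0; apply: (E_full subE wsE hxi lxi) => // G hG G1.
    have small (s : R -> R[i]) : Hinf s -> (forall t, cabs (s t) <= cabs (xi t) + cabs (G t)) ->
        qnorm E s <= 1.
      move=> hs sle.
      apply: (@le_trans _ _ (normInf s)).
        by apply: qnorm_le => //; apply: Ext (E0 subE) => t; rewrite subrr.
      apply: normInf_le => //; apply: aecS G1 => t _ h.
      by apply: le_trans (sle t) _; lra.
    have hp := HinfD hxi hG; have hm := HinfB hxi hG.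
    have sp : qnorm E (fun t => xi t + G t) <= 1.
      by apply: small => // t; exact: cabsD.
    have sm : qnorm E (fun t => xi t - G t) <= 1.
      by apply: small => // t; apply: le_trans (cabsD _ _) _; rewrite cabsN.
    have Emid : E (fun t => f t - (xi t + G t + (xi t - G t)) / 2%:R).
      by apply: Ext (EN subE Exi) => t; field.
    have := Ez 2^-1 _ (ext _ _ hp hm sp sm Emid).
    by apply: Ext => t; field.
  have [h [hh Eh h1]] := qnorm_attained subE wsE hf (ltac:(by rewrite qf)).
  exists h; split=> //; [exact: norm1|exact: noL1|].
  split=> //; first by rewrite qf; exact: norm1.
  move=> xi hxi Exi nxi; apply: contrapT => nae.
  have xi1 : aec (fun t => cabs (xi t) <= 1).
    by apply: normInf_bnd; [case: hxi|rewrite nxi qf].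
  (* Two distinct best approximations m + g and m - g would make log (1 - |m|) integrable, although
     m is again a representative in the ball. *)
  pose m t := 2^-1 * (xi t + h t); pose g t := 2^-1 * (xi t - h t).
  have hm : Hinf m by apply: HinfZ; exact: HinfD.
  have hg : Hinf g by apply: HinfZ; exact: HinfB.
  have mg1 t : m t + g t = xi t by rewrite /m /g; field.
  have mg2 t : m t - g t = h t by rewrite /m /g; field.
  apply: (@noL1 m) => //.
  + by apply: Ext (Ez 2^-1 _ (Ed _ _ Exi Eh)) => t; rewrite /m; field.
  + apply: aecS (aecI xi1 h1) => t _ [a b].
    by rewrite /m mulrC; exact: cabs_mid.
  + apply: (log1m_abs_L1_perturb (g := g)) => //; first by case: hm => -[].
    * by apply: aecS xi1 => t _; rewrite mg1.
    * by apply: aecS h1 => t _; rewrite mg2.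
    * move=> g0'; apply: nae; apply: aecS g0' => t _ gt0.
      by rewrite -mg1 -mg2 gt0 addr0 subr0.
- split; first by rewrite qf.
  move=> g k hg hk qg qk Efgk.
  (* Attainment turns a decomposition of the coset into one of functions in the unit ball, whose
     midpoint must be [h] by uniqueness. *)
  have [g' [hg' Eg' g1]] := qnorm_attained subE wsE hg qg.
  have [k' [hk' Ek' k1]] := qnorm_attained subE wsE hk qk.
  pose m t := 2^-1 * (g' t + k' t); pose u t := 2^-1 * (g' t - k' t).
  have hm : Hinf m by apply: HinfZ; exact: HinfD.
  have hu : Hinf u by apply: HinfZ; exact: HinfB.
  have Em : E (fun t => m t - f t).
    apply: Ext (Ed _ _ (Ez 2^-1 _ (Ed _ _ Eg' Ek')) (EN subE Efgk)) => t.
    by rewrite /m; field.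
  have m1 : aec (fun t => cabs (m t) <= 1).
    apply: aecS (aecI g1 k1) => t _ [a b].
    by rewrite /m mulrC; exact: cabs_mid.
  have mh : aec (fun t => m t = h t) by apply: uniq => //; rewrite qf; exact: norm1.
  (* Otherwise h + u = g' and h - u = k' in the ball would make log (1 - |h|) integrable. *)
  have u0 : aec (fun t => u t = 0).
    apply: contrapT => nu; apply: lh.
    apply: (log1m_abs_L1_perturb (g := u)) => //; first by case: hh => -[].
      apply: aecS (aecI mh g1) => t _ [<- a].
      by rewrite (_ : m t + u t = g' t)// /m /u; field.
    apply: aecS (aecI mh k1) => t _ [<- a].
    by rewrite (_ : m t - u t = k' t)// /m /u; field.
  have Egk' : E (fun t => g' t - k' t).
    apply: Ea (E0 subE) _ _; first exact: HinfB.
    apply: (@aecS _ (fun t => u t = 0)) u0 => t _ ut.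
    have -> : g' t - k' t = 2 * u t by rewrite /u; field.
    by rewrite ut mulr0.
  by apply: Ext (Ed _ _ (Ed _ _ Egk' (EN subE Eg')) Ek') => t; ring.
Qed.
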